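(* For every boolean function $f:\{0,1\}^n\to\{0,1\}$: \begin{align*} n(f) &\leq 4.394 \cdot 2^{\deg(f)},\\ n(f) &\leq \tfrac{1}{2}\cdot 4^{C(f)},\\ n(f) &\leq 8.277\cdot 2^{\frac{\deg(f)}{2} + s(f)}, \end{align*} and, if $f$ is non-constant, \[ n(f) \leq (\log s(f) + 0.29)\cdot 4^{\frac{C(f) + s(f)}{2}}. \] Moreover, if $f$ is monotone, then \[ n(f) \leq \min\left\{1.325 \cdot 2^{\deg(f)},\ \tfrac{1}{2}\cdot 4^{s(f)},\ \tfrac{1}{4}\cdot 2^{\mathrm{DT}(f)} + 2 \right\}. \]
   Context: A boolean function is a map $f:\{0,1\}^n\to\{0,1\}$. For $x\in\{0,1\}^n$ and $S\subseteq[n]$, $x^S$ is $x$ with the bits in $S$ flipped, and $x^i:=x^{\{i\}}$. A coordinate $i$ is relevant for $f$ if $f(x)\neq f(x^i)$ for some $x$; $n(f)$ is the number of relevant coordinates. $\deg(f)$ is the degree of the unique multilinear real polynomial agreeing with $f$ on $\{0,1\}^n$. The sensitivity $s_x(f)$ is the number of $i$ with $f(x)\neq f(x^i)$, and $s(f)=\max_x s_x(f)$. $C_x(f)$ is the smallest size of a set $S\subseteq[n]$ such that $f$ is constant on $\{y: y_i=x_i \ \forall i\in S\}$, and $C(f)=\max_x C_x(f)$. $\mathrm{DT}(f)$ is the minimum depth of a deterministic decision tree computing $f$. $f$ is monotone if $x\le y$ coordinatewise implies $f(x)\le f(y)$. Here $\log$ denotes the natural logarithm. *)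

(* Defs.v *)
From mathcomp Require Import all_boot all_order all_algebra.
From mathcomp Require Import boolp reals.
From mathcomp Require Import mpoly.

Set Implicit Arguments.
Unset Strict Implicit.
Unset Printing Implicit Defensive.

Import GRing.Theory.

Local Open Scope ring_scope.

Notation cube n := {ffun 'I_n -> bool}.
Notation boolfun n := (cube n -> bool).

Definition flip n (x : cube n) (S : {set 'I_n}) : cube n :=
  [ffun i => if i \in S then ~~ x i else x i].

Definition relevant n (f : boolfun n) (i : 'I_n) : bool :=
  [exists x, f x != f (flip x [set i])].

Definition nrelevant n (f : boolfun n) : nat := #|[set i | relevant f i]|.

Definition multilinear (R : comNzRingType) n (p : {mpoly R[n]}) : bool :=
  all (fun m : 'X_{1..n} => [forall i, m i <= 1]%N) (msupp p).

Definition represents (R : comNzRingType) n (p : {mpoly R[n]}) (f : boolfun n)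
  : bool := [forall x : cube n, p.@[fun i => (x i)%:R] == (f x)%:R].

Lemma mlpoly_exists (R : comNzRingType) n (f : boolfun n) :
  exists p : {mpoly R[n]}, multilinear p && represents p f.
Proof.
have mlD (p q : {mpoly R[n]}) :
    multilinear p -> multilinear q -> multilinear (p + q).
  move=> /allP mlp /allP mlq; apply/allP => m /msuppD_le.
  by rewrite mem_cat => /orP[/mlp|/mlq].
have mlZ c (p : {mpoly R[n]}) : multilinear p -> multilinear (c *: p).
  by move=> /allP mlp; apply/allP => m /msuppZ_le /mlp.
have ml0 : multilinear (0 : {mpoly R[n]}) by rewrite /multilinear msupp0.
pose lit (a : cube n) i (b : bool) : R :=
  if b then (if a i then 1 else -1) else (if a i then 0 else 1).
pose ind (a : cube n) : {mpoly R[n]} :=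
  \prod_i \sum_(b : bool) (lit a i b *: 'X_i ^+ b).
have ml_ind a : multilinear (ind a).
  rewrite /ind bigA_distr_bigA; elim/big_rec: _ => // b p _ mlp.
  apply: mlD mlp; rewrite scaler_prod; apply: mlZ.
  pose m := [multinom (b i : nat) | i < n].
  have -> : \prod_i 'X_i ^+ b i = 'X_[m] :> {mpoly R[n]}.
    by rewrite mpolyXE_id; apply: eq_bigr => i _; rewrite mnmE.
  rewrite /multilinear msuppX /= andbT.
  by apply/forallP => i; rewrite mnmE leq_b1.
have ev_ind a (x : cube n) : (ind a).@[fun i => (x i)%:R] = (a == x)%:R.
  rewrite /ind rmorph_prod /=.
  under eq_bigr => i _ do
    rewrite big_bool /= mevalD !mevalZ expr1 expr0 mevalXU meval1.
  have [<-|/eqP neq] := eqVneq a x.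
    by apply: big1 => i _; rewrite /lit; case: (a i);
       rewrite !(mulr1, mul0r, mulr0, addr0, add0r).
  have /existsP [i ni] : [exists i, a i != x i].
    apply: contra_notT neq => /existsPn H; apply/ffunP => i.
    by apply/eqP; have := H i; rewrite negbK.
  rewrite (bigD1 i) //= /lit; case: (a i) (x i) ni => [] [] //= _.
    by rewrite mulr0 mul0r addr0 mul0r.
  by rewrite !mulr1 addNr mul0r.
exists (\sum_a (f a)%:R *: ind a); apply/andP; split.
  by elim/big_rec: _ => // a p _ mlp; apply: mlD mlp; apply: mlZ.
apply/forallP => x; apply/eqP; rewrite raddf_sum (bigD1 x) //= big1 ?addr0.
  by rewrite mevalZ ev_ind eqxx mulr1.
by move=> a /negPf nax; rewrite mevalZ ev_ind nax mulr0.
Qed.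

Lemma mlpoly_unique (R : comNzRingType) n (f : boolfun n) (p q : {mpoly R[n]}) :
  multilinear p -> represents p f -> multilinear q -> represents q f -> p = q.
Proof.
move=> /allP mlp /forallP rp /allP mlq /forallP rq.
have mld m : m \in msupp (p - q) -> forall i, (m i <= 1)%N.
  move=> /msuppB_le; rewrite mem_cat => /orP[/mlp|/mlq] /forallP; exact.
apply/eqP; rewrite -subr_eq0 -msupp_eq0; apply/negPn/negP => nz.
have /hasP [m0 m0in _] : has predT (msupp (p - q)).
  by rewrite has_predT lt0n size_eq0.
have [m m_in m_min] : exists2 m, m \in msupp (p - q) &
    forall m', m' \in msupp (p - q) -> (mdeg m <= mdeg m')%N.
  have ex : exists k, has (fun m => mdeg m == k) (msupp (p - q)).
    by exists (mdeg m0); apply/hasP; exists m0.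
  case: (ex_minnP ex) => k /hasP [m m_in /eqP <-] kmin.
  by exists m => // m' m'_in; apply: kmin; apply/hasP; exists m'.
pose x : cube n := [ffun i => m i != 0%N].
have : (p - q).@[fun i => (x i)%:R] = 0.
  by rewrite mevalB (eqP (rp x)) (eqP (rq x)) subrr.
rewrite mevalE (bigD1_seq m) ?msupp_uniq //= [X in _ + X]big1_seq ?addr0; last first.
  move=> m' /andP[nm m'_in].
  have [/forallP le|] := boolP [forall i, m' i <= m i]%N.
    case/eqP: nm; have lem : (m' <= m)%MM by apply/mnm_lepP.
    have := m_min _ m'_in; rewrite -{1}(submK lem) mdegD.
    rewrite -{2}[mdeg m']add0n leq_add2r leqn0 mdeg_eq0 => /eqP e.
    by rewrite -(submK lem) e add0m.
  rewrite negb_forall => /existsP [i]; rewrite -ltnNge => lti.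
  have m'1 := mld _ m'_in i.
  have mi0 : m i = 0%N by apply/eqP; rewrite -leqn0 -ltnS (leq_trans lti).
  rewrite (bigD1 i) //= ffunE mi0 eqxx /= expr0n.
  by rewrite -leqn0 leqNgt (leq_ltn_trans _ lti) //= mul0r mulr0.
rewrite big1 ?mulr1; last first.
  by move=> i _; rewrite ffunE; case: (m i) => [|k]; rewrite ?expr0 ?expr1n.
by move/eqP; rewrite mcoeff_eq0 m_in.
Qed.

Definition mlpoly (R : comNzRingType) n (f : boolfun n) : {mpoly R[n]} :=
  xchoose (mlpoly_exists R f).

(* The polynomial is determined by [f], see [mlpoly_unique].
   [msize p] is one more than the total degree of [p], and [msize 0 = 0]; the
   zero function thus gets degree 0. *)
Definition deg (R : realType) n (f : boolfun n) : nat := (msize (mlpoly R f)).-1.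

Definition sens_at n (f : boolfun n) (x : cube n) : nat :=
  #|[set i | f x != f (flip x [set i])]|.

Definition sens n (f : boolfun n) : nat := \max_(x : cube n) sens_at f x.

Definition is_cert n (f : boolfun n) (x : cube n) (S : {set 'I_n}) : bool :=
  let subcube := [set y : cube n | [forall i in S, y i == x i]] in
  [forall y in subcube, forall z in subcube, f y == f z].

Lemma is_certT n (f : boolfun n) (x : cube n) : is_cert f x [set: 'I_n].
Proof.
have eqx (y : cube n) :
    y \in [set y : cube n | [forall i in [set: 'I_n], y i == x i]] -> y = x.
  rewrite inE => /forall_inP H; apply/ffunP => i; exact/eqP/H.
by apply/forall_inP => y /eqx ->; apply/forall_inP => z /eqx ->.
Qed.

(* By [is_certT] the minimum ranges over a nonempty family. *)
Definition cert_at n (f : boolfun n) (x : cube n) : nat :=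
  #|[arg min_(S < [set: 'I_n] | is_cert f x S) #|S|]|.

Definition cert n (f : boolfun n) : nat := \max_(x : cube n) cert_at f x.

Inductive dtree (n : nat) : Type :=
| Leaf of bool
| Query of 'I_n & dtree n & dtree n.

Arguments Leaf {n} _.

Fixpoint dt_eval n (t : dtree n) (x : cube n) : bool :=
  match t with
  | Leaf b => b
  | Query i t0 t1 => if x i then dt_eval t1 x else dt_eval t0 x
  end.

Fixpoint dt_depth n (t : dtree n) : nat :=
  match t with
  | Leaf _ => 0
  | Query _ t0 t1 => (maxn (dt_depth t0) (dt_depth t1)).+1
  end.

Definition dt_computes n (t : dtree n) (f : boolfun n) : Prop :=
  forall x, dt_eval t x = f x.

Lemma dt_exists n (f : boolfun n) :
  exists d, `[< exists2 t, dt_computes t f & dt_depth t = d >].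
Proof.
suff [t ct] : exists t, dt_computes t f.
  by exists (dt_depth t); apply/asboolP; exists t.
suff H (s : seq 'I_n) (a : cube n) : exists t : dtree n, forall x : cube n,
    (forall i, i \notin s -> x i = a i) -> dt_eval t x = f x.
  have [t ct] := H (enum 'I_n) [ffun=> false].
  by exists t => x; apply: ct => i; rewrite mem_enum.
elim: s a => [|j s IH] a.
  by exists (Leaf (f a)) => x xa; congr f; apply/ffunP => i; rewrite xa.
pose set_j b : cube n := [ffun i => if i == j then b else a i].
have [t0 c0] := IH (set_j false); have [t1 c1] := IH (set_j true).
exists (Query j t0 t1) => x xa /=.
by case xj: (x j); [apply: c1|apply: c0] => i nis; rewrite ffunE;
   case: eqP => [->//|/eqP ne]; apply: xa; rewrite inE negb_or ne.
Qed.

Definition DT n (f : boolfun n) : nat := ex_minn (dt_exists f).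

Definition boolfun_monotone n (f : boolfun n) : Prop :=
  forall x y : cube n, (forall i, x i <= y i)%N -> (f x <= f y)%N.

Definition boolfun_nonconstant n (f : boolfun n) : Prop := exists x y, f x <> f y.

(* Main.v *)
(* A weight [w f i] that does not decrease when a variable is fixed, and at least
   doubles if fixing it the other way makes [i] irrelevant, satisfies
   [sum_i w f i <= sum_(i in H) w f i + E (sum_i w f_H i)], with [f_H] a random
   restriction of the variables in [H]; moreover [w f i] is at most the influence
   of [i]. Counting relevant variables amounts to bounding such sums, for
   [u_i = 2^(1 - d_i)], with [d_i] the size of the largest monomial containing
   [i], and for [v_i = 2^(- sigma_i)], with [sigma_i + 2] the largest sum of the
   sensitivities at the two ends of an edge in direction [i].

   Degree: the monomials of size above 13 are hit greedily, and the cost of this is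
   controlled by a fractional form of the bound block sensitivity <= degree^2;
   for small degree, the Fourier distribution of [f] is thinned until [i]
   appears with probability exactly [u_i], and the same packing bound controls
   the mean size of the resulting set. The weight [sqrt (u_i v_i)] gives the bound
   mixing degree and sensitivity.

   Certificates: two certificates of an edge in direction [i] yield a subcube of
   codimension at most [2 C - 2] on which [f] is [x_i] or its negation; the edges
   in direction [i] of these subcubes form a forest. Multiplying this bound by the
   one given by [v_i], whose sum is estimated by restricting the variables of
   opposite certificates, bounds the square of the number of variables.

   Monotone functions: a monomial of maximal size makes [f] constant when all its
   variables are set to the same value. For decision trees, the
   subfunctions [f_0 <= f_1] of the root are separated by a function of their
   common variables; when these are at most two, one of them forces the value of
   [f_0] or of [f_1], which saves a level of the tree. *)

Require Import Defs.
From mathcomp Require Import all_boot all_order all_algebra.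
From mathcomp Require Import all_classical all_reals all_analysis.
From mathcomp Require Import (canonicals, coercions) mpoly.
From mathcomp Require Import fintype finset ring lra zify.
Import Order.TTheory GRing.Theory Num.Theory.
Local Open Scope ring_scope.
Set Implicit Arguments.
Unset Strict Implicit.
Unset Printing Implicit Defensive.

(** * Flips, mixtures and restrictions on the cube *)

Section Cube.
Variable n : nat.
Implicit Types (x y a : cube n) (S T U H : {set 'I_n}) (i h : 'I_n).

Lemma flip0 x : flip x set0 = x.
Proof. by apply/ffunP => i; rewrite ffunE inE. Qed.

Lemma flipK x S : flip (flip x S) S = x.
Proof. by apply/ffunP => i; rewrite !ffunE; case: (i \in S); rewrite ?negbK. Qed.

Lemma flipC x S T : flip (flip x S) T = flip (flip x T) S.
Proof. by apply/ffunP => i; rewrite !ffunE; case: (i \in S); case: (i \in T). Qed.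

Lemma flipU x S T : [disjoint S & T] -> flip (flip x S) T = flip x (S :|: T).
Proof.
move=> dST; apply/ffunP => i; rewrite !ffunE inE.
by case: (boolP (i \in S)) => [/(disjointFr dST) ->|] //=.
Qed.

Lemma flip1U x h S : h \notin S -> flip (flip x [set h]) S = flip x (h |: S).
Proof. by move=> hS; rewrite flipU // disjoints1. Qed.

Definition mix H a x : cube n := [ffun i => if i \in H then a i else x i].

Lemma mixid H x : mix H x x = x.
Proof. by apply/ffunP => i; rewrite ffunE; case: ifP. Qed.

Lemma mix_mix H h a x : mix H a (mix [set h] a x) = mix (h |: H) a x.
Proof.
by apply/ffunP => i; rewrite !ffunE !inE; case: (i == h); case: (i \in H).
Qed.

Lemma mix_flip H S a x : [disjoint S & H] -> mix H a (flip x S) = flip (mix H a x) S.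
Proof.
move=> d; apply/ffunP => i; rewrite !ffunE.
by case: (boolP (i \in H)) => // iH; rewrite (disjointFl d iH).
Qed.

Lemma mix_flipl H S a x : [disjoint S & H] -> mix H (flip a S) x = mix H a x.
Proof.
move=> d; apply/ffunP => i; rewrite !ffunE.
by case: (boolP (i \in H)) => // iH; rewrite (disjointFl d iH).
Qed.

Lemma mix_flipr H S a x : S \subset H -> mix H a (flip x S) = mix H a x.
Proof.
move=> /subsetP d; apply/ffunP => i; rewrite !ffunE.
by case: (boolP (i \in H)) => // iH; case: (boolP (i \in S)) => // /d; rewrite (negPf iH).
Qed.

Lemma mixC1 H a x : mix (~: H) x a = mix H a x.
Proof. by apply/ffunP => i; rewrite !ffunE inE; case: (i \in H). Qed.

(** A restriction stays a function on the whole cube, with the variables in [H] made irrelevant, so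
    iterated restriction involves no change of dimension. *)
Definition restr (f : boolfun n) H a : boolfun n := fun x => f (mix H a x).

Lemma restr_restr f H h a : restr (restr f H a) [set h] a = restr f (h |: H) a.
Proof. by apply/funext => x; rewrite /restr mix_mix. Qed.

Lemma restr_flipl f H S a : [disjoint S & H] -> restr f H (flip a S) = restr f H a.
Proof. by move=> d; apply/funext => x; rewrite /restr mix_flipl. Qed.

Lemma set_ind1 (T : finType) (P : {set T} -> Prop) : P set0 ->
  (forall (h : T) (A : {set T}), h \notin A -> P A -> P (h |: A)) -> forall A, P A.
Proof.
move=> P0 PS A; elim: {A}#|A| {-2}A (erefl #|A|) => [|k IH] A cA.
  by move/eqP: cA; rewrite cards_eq0 => /eqP ->.
have /card_gt0P [h hA] : (0 < #|A|)%N by rewrite cA.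
rewrite -(setD1K hA); apply: PS; first by rewrite !inE eqxx.
by apply: IH; move: (cardsD1 h A); rewrite hA cA => -[].
Qed.

End Cube.

Lemma big_subsetU1 (T : finType) (R : nmodType) (h : T) (A : {set T}) (F : {set T} -> R) :
  h \notin A ->
  \sum_(U : {set T} | U \subset h |: A) F U
  = \sum_(U : {set T} | U \subset A) (F U + F (h |: U)).
Proof.
move=> hA; rewrite big_split /= (bigID (fun U : {set T} => h \in U)) /= addrC.
congr (_ + _).
  apply: eq_bigl => U; apply/andP/idP => [[/subsetP s hU]|s].
    apply/subsetP => i iU; have := s _ iU; rewrite !inE => /orP[/eqP e|//].
    by rewrite -e iU in hU.
  split; first by apply: subset_trans s _; apply: subsetUr.
  by apply: contra hA; apply: (subsetP s).
rewrite (reindex_onto (fun U => h |: U) (fun U => U :\ h)) /=; last first.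
  by move=> U /andP[_ hU]; rewrite setD1K.
apply: eq_bigl => U; rewrite setU11 andbT; apply/andP/idP => [[s /eqP e]|s].
  apply/subsetP => i iU.
  have ih : i != h by apply/eqP => E; move: iU; rewrite -e E !inE eqxx.
  by have := subsetP s i; rewrite !inE iU orbT (negPf ih) => /(_ isT).
split; first exact: setUS.
apply/eqP/setP => i; rewrite !inE; case: (eqVneq i h) => //= ->.
by apply/esym/negbTE; apply: contra hA; apply: (subsetP s).
Qed.

(** * Averages over the uniform cube *)

Section Avg.
Variables (R : realType) (n : nat).
Implicit Types (F G : cube n -> R) (x : cube n) (S H : {set 'I_n}) (f : boolfun n).

Definition avg G : R := (\sum_x G x) / 2 ^+ n.

Lemma card_cube : #|{: cube n}| = (2 ^ n)%N.
Proof. by rewrite card_ffun card_bool card_ord. Qed.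

Lemma pow2_gt0 m : 0 < 2 ^+ m :> R. Proof. by rewrite exprn_gt0. Qed.
Lemma pow2_neq0 m : 2 ^+ m != 0 :> R. Proof. by rewrite gt_eqF ?pow2_gt0. Qed.

Lemma avg_cst c : avg (fun=> c) = c.
Proof.
by rewrite /avg sumr_const card_cube -[c *+ _]mulr_natr natrX mulfK ?pow2_neq0.
Qed.

Lemma avgD F G : avg (fun x => F x + G x) = avg F + avg G.
Proof. by rewrite /avg big_split mulrDl. Qed.

Lemma avgZ c F : avg (fun x => c * F x) = c * avg F.
Proof. by rewrite /avg -mulr_sumr mulrA. Qed.

Lemma avg_sum (I : Type) (r : seq I) (P : pred I) (F : I -> cube n -> R) :
  avg (fun x => \sum_(i <- r | P i) F i x) = \sum_(i <- r | P i) avg (F i).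
Proof. by rewrite /avg exchange_big /= mulr_suml. Qed.

Lemma ler_avg F G : (forall x, F x <= G x) -> avg F <= avg G.
Proof. by move=> FG; rewrite ler_pM2r ?invr_gt0 ?pow2_gt0 // ler_sum. Qed.

Lemma eq_avg F G : (forall x, F x = G x) -> avg F = avg G.
Proof. by move=> FG; rewrite /avg (eq_bigr _ (fun x _ => FG x)). Qed.

Lemma avg_ge0 F : (forall x, 0 <= F x) -> 0 <= avg F.
Proof. by move=> F0; rewrite divr_ge0 ?sumr_ge0 ?exprn_ge0. Qed.

Lemma avg_flip S F : avg (fun x => F (flip x S)) = avg F.
Proof.
congr (_ / _); rewrite [RHS](reindex_inj (h := fun x => flip x S)) //.
by move=> x y /(congr1 (fun z => flip z S)); rewrite !flipK.
Qed.

End Avg.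

(** * Weights under restriction, and influence *)

Section Weights.
Variables (R : realType) (n : nat).
Implicit Types (f : boolfun n) (x y a : cube n) (S H : {set 'I_n}) (i h : 'I_n).
Implicit Types (w : boolfun n -> 'I_n -> R).

Definition sbit f x i : bool := f x != f (flip x [set i]).

Lemma relevantP f i : reflect (exists x, sbit f x i) (relevant f i).
Proof. exact: existsP. Qed.

Lemma sbit_restr f H a x i : sbit (restr f H a) x i = (i \notin H) && sbit f (mix H a x) i.
Proof.
rewrite /sbit /restr; case: (boolP (i \in H)) => iH /=.
  by rewrite mix_flipr ?eqxx // sub1set.
by rewrite mix_flip // disjoints1.
Qed.

Lemma sbit_flip f x i : sbit f (flip x [set i]) i = sbit f x i.
Proof. by rewrite /sbit flipK eq_sym. Qed.

Lemma relevant_restr f H a i : relevant (restr f H a) i -> relevant f i /\ i \notin H.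
Proof.
move=> /relevantP [x]; rewrite sbit_restr => /andP[iH s]; split=> //.
by apply/relevantP; exists (mix H a x).
Qed.

(** A sensitive edge in a direction other than [h] lies entirely in one of the two halves cut by
    [h]. *)
Lemma relevant_split f i h x : i != h -> relevant f i ->
  relevant (restr f [set h] x) i || relevant (restr f [set h] (flip x [set h])) i.
Proof.
move=> ih /relevantP [y sy]; have [e|ne] := eqVneq (y h) (x h).
  apply/orP; left; apply/relevantP; exists y; rewrite sbit_restr inE ih /=.
  suff -> : mix [set h] x y = y by [].
  by apply/ffunP => j; rewrite ffunE inE; case: eqP => // ->.
apply/orP; right; apply/relevantP; exists y; rewrite sbit_restr inE ih /=.
suff -> : mix [set h] (flip x [set h]) y = y by [].
apply/ffunP => j; rewrite !ffunE !inE; case: eqP => // ->.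
by move: ne; case: (y h) (x h) => [] [].
Qed.

(* The shape of the restriction inequalities of a weight [2 ^ - m_i(f)], where
   [m_i] does not increase when a variable is fixed, and drops by at least one
   when one of the two values of that variable makes [i] irrelevant. *)
Definition is_weight w : Prop :=
  [/\ forall f i, 0 <= w f i <= 1,
      forall f i, ~~ relevant f i -> w f i = 0,
      forall f i h x, i != h -> relevant (restr f [set h] x) i ->
        relevant (restr f [set h] (flip x [set h])) i ->
        w f i <= w (restr f [set h] x) i
    & forall f i h x, i != h -> relevant (restr f [set h] x) i ->
        ~~ relevant (restr f [set h] (flip x [set h])) i ->
        2 * w f i <= w (restr f [set h] x) i].

(** If [i] stays relevant in both halves, the two plain inequalities add up; if in one only, the
    doubled inequality suffices; [relevant_split] excludes the third case. *)
Lemma weight_le_restr1 w f i h x : is_weight w -> i != h ->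
  2 * w f i <= w (restr f [set h] x) i + w (restr f [set h] (flip x [set h])) i.
Proof.
move=> [w01 w0 wrr wr] ih.
have w_ge0 g : 0 <= w g i by case/andP: (w01 g i).
case: (boolP (relevant f i)) => [fi|/w0 ->]; last by rewrite mulr0 addr_ge0.
case: (boolP (relevant (restr f [set h] x) i)) => r1;
  case: (boolP (relevant (restr f [set h] (flip x [set h])) i)) => r2.
- have := wrr _ _ _ x ih r1 r2.
  have := wrr _ _ _ (flip x [set h]) ih r2; rewrite flipK => /(_ r1).
  by move=> *; rewrite mulr2n mulrDl !mul1r addrC lerD.
- by apply: le_trans (wr _ _ _ _ ih r1 r2) _; rewrite lerDl.
- have := wr _ _ _ (flip x [set h]) ih r2; rewrite flipK => /(_ r1) H.
  by apply: le_trans H _; rewrite lerDr.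
- by have := relevant_split x ih fi; rewrite (negPf r1) (negPf r2).
Qed.

(** Variables are fixed one at a time, as for a submartingale: [avg] is invariant under flips, so
    each [x] is paired with its flip at [h] and [weight_le_restr1] applies to the pair. *)
Lemma weight_le_restr w f i H : is_weight w -> i \notin H ->
  w f i <= avg (fun x => w (restr f H x) i).
Proof.
move=> ww; elim/set_ind1: H => [|h H hH IH].
  move=> _; rewrite (_ : (fun x => _) = fun=> w f i) ?avg_cst //.
  apply/funext => x; congr (w _ i); apply/funext => y; congr f.
  by apply/ffunP => j; rewrite ffunE inE.
rewrite !inE negb_or => /andP[ih iH]; apply: le_trans (IH iH) _.
rewrite -(ler_pM2l (ltr0Sn R 1)) [leRHS]mulr_natl [leRHS]mulr2n.
rewrite -[X in _ <= _ + X](avg_flip [set h]) -avgD -avgZ; apply: ler_avg => x.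
apply: le_trans (weight_le_restr1 (restr f H x) x ww ih) _.
rewrite restr_restr lerD2l.
by rewrite -[restr f H x](@restr_flipl _ _ _ [set h]) ?disjoints1 // restr_restr.
Qed.

Definition influence f i : R := avg (fun x => (sbit f x i)%:R).

(** Fix every variable except [i]: the restriction has weight at most 1, and weight 0 unless [x] is
    an end of a sensitive edge in direction [i]. *)
Lemma weight_le_influence w f i : is_weight w -> w f i <= influence f i.
Proof.
move=> ww; apply: le_trans (weight_le_restr f ww (_ : i \notin ~: [set i])) _.
  by rewrite !inE eqxx.
apply: ler_avg => x; case: ww => w01 w0 _ _.
case: (boolP (relevant (restr f (~: [set i]) x) i)) => r; last first.
  by rewrite w0 ?ler0n.
case/andP: (w01 (restr f (~: [set i]) x) i) => _; move/le_trans; apply.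
move/relevantP: r => [y]; rewrite sbit_restr mixC1 => /andP[_ s].
suff -> : sbit f x i by [].
have [e|ne] := eqVneq (y i) (x i).
  suff <- : mix [set i] y x = x by [].
  by apply/ffunP => j; rewrite ffunE inE; case: eqP => // ->.
rewrite -sbit_flip; suff <- : mix [set i] y x = flip x [set i] by [].
apply/ffunP => j; rewrite !ffunE !inE; case: eqP => // ->.
by move: ne; case: (y i) (x i) => [] [].
Qed.

Lemma sum_weight_restr w f H : is_weight w ->
  \sum_i w f i <= \sum_(i in H) w f i + avg (fun x => \sum_i w (restr f H x) i).
Proof.
move=> ww; rewrite (bigID (mem H)) /= lerD2l avg_sum.
rewrite [leRHS](bigID (mem H)) /= -[leLHS]add0r lerD //.
  by apply: sumr_ge0 => i _; apply: avg_ge0 => x; case: ww => /(_ (restr f H x) i)/andP[].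
by apply: ler_sum => i iH; apply: weight_le_restr.
Qed.

Lemma sens_at_sum f x : (sens_at f x)%:R = \sum_i (sbit f x i)%:R :> R.
Proof.
rewrite -natr_sum /sens_at -sum1_card big_mkcond /=; congr _%:R.
by apply: eq_bigr => i _; rewrite inE /sbit; case: (_ != _).
Qed.

Lemma sum_influence f : \sum_i influence f i = avg (fun x => (sens_at f x)%:R).
Proof.
by rewrite -avg_sum; apply: eq_avg => x; rewrite sens_at_sum.
Qed.

Lemma sens_at_le f x : (sens_at f x <= sens f)%N.
Proof. exact: leq_bigmax. Qed.

Lemma sum_influence_le_sens f : \sum_i influence f i <= (sens f)%:R.
Proof.
rewrite sum_influence -(avg_cst n (sens f)%:R); apply: ler_avg => x.
by rewrite ler_nat sens_at_le.
Qed.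

End Weights.

(** * Discrete derivatives along sets of directions *)

Section Derivatives.
Variables (R : realType) (n : nat).
Implicit Types (g : cube n -> R) (x y : cube n) (S T U V : {set 'I_n}) (i h : 'I_n).

(* Up to a sign depending on [x], the coefficient of the monomial [S] in the
   restriction of [g] to the subcube of [x] in the directions of [S]. *)
Definition der g S x : R := \sum_(U : {set 'I_n} | U \subset S) (-1) ^+ #|U| * g (flip x U).

Lemma der0 g x : der g set0 x = g x.
Proof.
rewrite /der (big_pred1 set0) ?cards0 ?mul1r ?flip0 // => U.
by rewrite subset0.
Qed.

Lemma derU1 g h S x : h \notin S ->
  der g (h |: S) x = der g S x - der g S (flip x [set h]).
Proof.
move=> hS; rewrite /der big_subsetU1 // big_split -sumrN; congr (_ + _).
apply: eq_bigr => U US; have hU : h \notin U by apply: contra hS; apply: (subsetP US).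
by rewrite cardsU1 hU exprS mulN1r mulNr flip1U.
Qed.

Lemma der_flip1 g i S x : i \in S -> der g S (flip x [set i]) = - der g S x.
Proof.
move=> iS; rewrite -(setD1K iS) !derU1 ?inE ?eqxx // flipK.
by rewrite opprB.
Qed.

Lemma der_eq0 g S x i : i \in S ->
  (forall U, U \subset S :\ i -> g (flip x (i |: U)) = g (flip x U)) -> der g S x = 0.
Proof.
move=> iS e; rewrite -(setD1K iS) derU1 ?inE ?eqxx //; apply/eqP; rewrite subr_eq0.
apply/eqP; apply: eq_bigr => U US.
have iU : i \notin U by apply/negP => /(subsetP US); rewrite !inE eqxx.
by rewrite flip1U // e.
Qed.

Lemma der_indep g i S x : i \in S -> (forall y, g (flip y [set i]) = g y) ->
  der g S x = 0.
Proof.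
move=> iS e; apply: (der_eq0 iS) => U US.
have iU : i \notin U by apply/negP => /(subsetP US); rewrite !inE eqxx.
by rewrite -flip1U // flipC e.
Qed.

(** Moebius inversion over the subsets of [B], that is, the expansion of [g] around the base point
    [x]. *)
Lemma der_mobius g B x :
  g (flip x B) = \sum_(T : {set 'I_n} | T \subset B) (-1) ^+ #|T| * der g T x.
Proof.
elim/set_ind1: B x => [|h B hB IH] x.
  rewrite flip0 (big_pred1 set0) ?cards0 ?mul1r ?der0 // => U.
  by rewrite subset0.
rewrite big_subsetU1 // -flip1U // IH; apply: eq_bigr => T TB.
have hT : h \notin T by apply: contra hB; apply: (subsetP TB).
rewrite cardsU1 hT derU1 // exprS; ring.
Qed.

(** The derivative along [T] is a signed sum of derivatives along [S] at the flips of [x] inside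
    [T :\: S], so these cannot all vanish. *)
Lemma der_sub_neq0 g S T x : S \subset T -> der g T x != 0 ->
  exists2 V : {set 'I_n}, V \subset T :\: S & der g S (flip x V) != 0.
Proof.
move=> ST; have {1}-> : T = (T :\: S) :|: S.
  by apply/setP => i; rewrite !inE; case: (boolP (i \in S)) => [/(subsetP ST) ->|]; rewrite ?orbT ?orbF.
have : [disjoint T :\: S & S] by rewrite -setI_eq0 setDE -setIA [_ :&: S]setIC setICr setI0.
elim/set_ind1: (T :\: S) x => [|h D hD IH] x dDS.
  by rewrite set0U => d; exists set0; rewrite ?sub0set // flip0.
have hS : h \notin S.
  by apply/negP => hS; have := disjointFl dDS hS; rewrite !inE eqxx.
have {}dDS : [disjoint D & S].
  by apply: disjointWl dDS; apply: subsetUr.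
rewrite -setUA derU1 ?inE ?(negPf hS) ?orbF //.
case: (boolP (der g (D :|: S) x == 0)) => [/eqP ->|nz _]; last first.
  have [V VD d] := IH x dDS nz; exists V => //.
  by apply: subset_trans VD _; apply: subsetUr.
rewrite sub0r oppr_eq0 => nz; have [V VD d] := IH _ dDS nz.
exists (h |: V); first exact: setUS.
by rewrite -flip1U //; apply: contra hD; apply: (subsetP VD).
Qed.

End Derivatives.

(** * Monomials, their activity, and the degree weight *)

Section Mono.
Variables (R : realType) (n : nat).
Implicit Types (f : boolfun n) (x y a : cube n) (S T U V H : {set 'I_n}) (i h : 'I_n).

Notation bder f := (der (fun y => (f y)%:R : R)).

(** The derivative along [S] is not identically zero exactly when some monomial of [f] contains [S].
    Hence the maximal sets with this property are the maximal monomials. *)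
Definition mono f S : bool := [exists x, bder f S x != 0].

Lemma monoP f S : reflect (exists x, bder f S x != 0) (mono f S).
Proof. exact: existsP. Qed.

Lemma mono_sub f S T : S \subset T -> mono f T -> mono f S.
Proof.
move=> ST /monoP [x d]; have [V _ dV] := der_sub_neq0 ST d.
by apply/monoP; exists (flip x V).
Qed.

Lemma bder1 f i x : (bder f [set i] x != 0) = sbit f x i.
Proof.
rewrite -{1}(setU0 [set i]) derU1 ?inE // !der0 subr_eq0 eqr_nat /sbit.
by case: (f x); case: (f _).
Qed.

Lemma mono1 f i : mono f [set i] = relevant f i.
Proof. by apply: eq_existsb => x; rewrite bder1. Qed.

Lemma mono_relevant f S i : mono f S -> i \in S -> relevant f i.
Proof. by move=> mS iS; rewrite -mono1; apply: mono_sub mS; rewrite sub1set. Qed.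

Lemma bder_irrelevant f i S x : i \in S -> ~~ relevant f i -> bder f S x = 0.
Proof.
move=> iS r; apply: (@der_indep R n _ i) => // y; congr (nat_of_bool _)%:R.
by apply/esym/eqP; apply: contraNT r => s; apply/existsP; exists y; exact: s.
Qed.

Lemma bder_sens f S x : S != set0 -> bder f S x != 0 ->
  exists2 U : {set 'I_n}, U \subset S & f (flip x U) != f x.
Proof.
move=> /set0Pn [i iS] d; apply/exists_inP; apply: contraNT d => /exists_inPn e.
have {}e (U : {set 'I_n}) : U \subset S -> f (flip x U) = f x.
  by move=> US; apply/eqP; rewrite -[_ == _]negbK; apply: e.
apply/eqP; apply: (der_eq0 iS) => U US; rewrite !e //.
  exact: subset_trans US (subD1set _ _).
by rewrite -(setD1K iS) setUS.
Qed.

Lemma bder_restr f H a S x :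
  bder (restr f H a) S x = if [disjoint S & H] then bder f S (mix H a x) else 0.
Proof.
case: ifP => dSH.
  apply: eq_bigr => U US; rewrite /restr mix_flip //.
  exact: disjointWl dSH.
move: dSH => /negbT; rewrite -setI_eq0 => /set0Pn [i]; rewrite inE => /andP[iS iH].
by apply: (@der_indep R n _ i) => // y; rewrite /restr mix_flipr // sub1set.
Qed.

Lemma mono_restr f H a S : mono (restr f H a) S -> mono f S /\ [disjoint S & H].
Proof.
move=> /monoP [x]; rewrite bder_restr; case: ifP => [_ d|]; last by rewrite eqxx.
by split=> //; apply/monoP; exists (mix H a x).
Qed.

(** For [i] outside a maximal [T] the derivative along [i |: T] vanishes everywhere, so the
    derivative along [T] is constant up to sign. *)
Lemma bder_max f T x : maxset (mono f) T -> bder f T x != 0.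
Proof.
move=> mT; have [/monoP [y dy] maxT] := maxsetP mT.
have st z i : bder f T z != 0 -> bder f T (flip z [set i]) != 0.
  case: (boolP (i \in T)) => iT; first by rewrite der_flip1 // oppr_eq0.
  have : bder f (i |: T) z == 0.
    apply/negPn/negP => nz; have := maxT (i |: T) _ (subsetUr _ _).
    move=> e; have : i \in T by rewrite -e ?setU11 //; apply/monoP; exists z.
    by rewrite (negPf iT).
  by rewrite derU1 // subr_eq0 => /eqP ->.
suff H D z : bder f T z != 0 -> bder f T (flip z D) != 0.
  have -> : x = flip y [set i | x i != y i]; last exact: H.
  by apply/ffunP => i; rewrite ffunE inE; case: (x i) (y i) => [] [].
elim/set_ind1: D z => [|h D hD IH] z dz; first by rewrite flip0.
by rewrite -flip1U //; apply/IH/st.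
Qed.

(** By [bder_max] and [der_sub_neq0], every point becomes active for [S] after one of the
    [2 ^ (|T| - |S|)] flips inside [T :\: S]; averaging over these flips gives the estimate. *)
Lemma mono_active f S : mono f S -> exists T, [/\ S \subset T, maxset (mono f) T
  & 2 ^+ #|S| <= 2 ^+ #|T| * avg (fun x => (bder f S x != 0)%:R : R)].
Proof.
move=> mS; have [T mT ST] := maxset_exists mS; exists T; split=> //.
have -> : #|T| = (#|S| + #|T :\: S|)%N.
  by rewrite -(cardsID S T) (setIidPr ST).
rewrite exprD -mulrA ler_peMr ?exprn_ge0 // -natrX -card_powerset mulr_natl.
rewrite -sumr_const (eq_bigr (fun V =>
  avg (fun x => (bder f S (flip x V) != 0)%:R))); last first.
  by move=> V _; rewrite (avg_flip V (fun x => (bder f S x != 0)%:R : R)).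
rewrite -avg_sum; apply: (@le_trans _ _ (avg (fun=> 1))); first by rewrite avg_cst.
apply: ler_avg => x.
have [V VD d] := der_sub_neq0 ST (bder_max x mT).
rewrite (bigD1 V) /= ?powersetE // d lerDl.
by apply: sumr_ge0 => *; apply: ler0n.
Qed.

Definition locdeg f i : nat := \max_(S : {set 'I_n} | mono f S && (i \in S)) #|S|.

Lemma locdeg_ge f S i : mono f S -> i \in S -> (#|S| <= locdeg f i)%N.
Proof. by move=> mS iS; apply: leq_bigmax_cond; rewrite mS iS. Qed.

Lemma locdeg_le f d i : (forall S, mono f S -> (#|S| <= d)%N) -> (locdeg f i <= d)%N.
Proof. by move=> H; apply/bigmax_leqP => S /andP[/H]. Qed.

Lemma locdeg_gt0 f i : relevant f i -> (0 < locdeg f i)%N.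
Proof. by rewrite -mono1 => /locdeg_ge /(_ (set11 i)); rewrite cards1. Qed.

Definition dweight f i : R := if relevant f i then 2 / 2 ^+ locdeg f i else 0.

Lemma dweight_ge0 f i : 0 <= dweight f i.
Proof. by rewrite /dweight; case: ifP => // _; rewrite divr_ge0 ?exprn_ge0. Qed.

(** For the doubling clause: if [i] is irrelevant in the other half, derivatives along sets [S]
    containing [i] vanish there, so the derivative of [f] along [h |: S] equals the one in the first
    half, and every monomial through [i] extends by [h]. *)
Lemma dweight_is_weight : is_weight dweight.
Proof.
split=> [f i|f i /negPf r|f i h x ih r1 r2|f i h x ih r1 r2].
- rewrite dweight_ge0 /dweight; case: ifP => r; last by rewrite ler01.
  rewrite ler_pdivrMr ?pow2_gt0 // mul1r -{1}(expr1 2) ler_eXn2l ?ltr1n //.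
  exact: locdeg_gt0.
- by rewrite /dweight r.
- have [r _] := relevant_restr r1; rewrite /dweight r r1.
  rewrite ler_pM2l ?ltr0n // lef_pV2 ?posrE ?pow2_gt0 // ler_eXn2l ?ltr1n //.
  by apply/bigmax_leqP => S /andP[/mono_restr [mS _] iS]; apply: locdeg_ge.
have [r _] := relevant_restr r1; rewrite /dweight r r1.
suff le : (locdeg (restr f [set h] x) i < locdeg f i)%N.
  rewrite ler_pM2l ?ltr0n // ler_pdivrMr ?pow2_gt0 // ler_pdivlMl ?pow2_gt0 //.
  by rewrite -exprSr ler_eXn2l ?ltr1n.
rewrite -[X in (_ < X)%N](prednK (locdeg_gt0 r)) ltnS.
apply/bigmax_leqP => S /andP[/monoP [y dy] iS].
rewrite -ltnS (prednK (locdeg_gt0 r)).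
move: dy; rewrite bder_restr; case: ifP; last by rewrite eqxx.
rewrite disjoint_sym disjoints1 => hS d.
have := bder_irrelevant y iS r2; rewrite bder_restr disjoint_sym disjoints1 hS => d'.
suff : mono f (h |: S) by move=> /locdeg_ge /(_ (setU1r _ iS)); rewrite cardsU1 hS.
apply/monoP; exists (mix [set h] x y); rewrite derU1 //.
suff -> : flip (mix [set h] x y) [set h] = mix [set h] (flip x [set h]) y by rewrite d' subr0.
by apply/ffunP => j; rewrite !ffunE !inE; case: (j == h).
Qed.

End Mono.

(** * Monomials and the degree of the representing polynomial *)

Section Degree.
Variables (R : realType) (n : nat).
Implicit Types (f : boolfun n) (S : {set 'I_n}).

(** If [S] is larger than the degree, each monomial of [mlpoly] misses a variable of [S], and the
    derivative along [S] kills it. *)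
Lemma mono_deg f S : mono R f S -> (#|S| <= deg R f)%N.
Proof.
move=> /monoP [x]; apply: contraNT; rewrite -ltnNge => dS; apply/eqP.
have /andP[_ /forallP rep] : Defs.multilinear (mlpoly R f) && represents (mlpoly R f) f.
  rewrite /mlpoly; match goal with |- context [@xchoose ?T ?P ?e] =>
    exact: (@xchooseP T P e) end.
transitivity (\sum_(m <- mpoly.msupp (mlpoly R f)) mpoly.mcoeff m (mlpoly R f) *
   der (fun y : cube n => \prod_i ((y i)%:R : R) ^+ mpoly.fun_of_multinom m i) S x).
  rewrite /der; under [RHS]eq_bigr => m _ do rewrite mulr_sumr.
  rewrite exchange_big /=; apply: eq_bigr => U _.
  rewrite -(eqP (rep (flip x U))) mpoly.mevalE mulr_sumr.
  by apply: eq_bigr => m _; rewrite mulrCA.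
rewrite big1_seq // => m /andP[_ ms].
have /exists_inP [i iS /eqP mi0] : [exists i in S, mpoly.fun_of_multinom m i == 0%N].
  apply: contraLR dS => /exists_inPn m_gt0; rewrite -leqNgt /deg.
  have /(leq_trans _) : (mpoly.mdeg m <= (mpoly.msize (mlpoly R f)).-1)%N.
    by rewrite -ltnS (leq_trans (mpoly.msize_mdeg_lt ms)) // leqSpred.
  apply; rewrite mpoly.mdegE -sum1_card big_mkcond /=; apply: leq_sum => i _.
  by case: ifP => // iS; rewrite lt0n m_gt0.
rewrite (@der_indep R n _ i) ?mulr0 // => y; apply: eq_bigr => j _; rewrite ffunE inE.
by case: eqP => // ->; rewrite mi0 !expr0.
Qed.
End Degree.

(** * Chebyshev polynomials and Markov's inequality at an endpoint *)

Section Markov.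
Variable R : realType.
Implicit Types (p q s : {poly R}).

Lemma lagrange_interp m (x : 'I_m -> R) s : injective x -> (size s <= m)%N ->
  s = \sum_k s.[x k] *: \prod_(j | j != k) ((x k - x j)^-1 *: ('X - (x j)%:P)).
Proof.
move=> xinj sm; apply/eqP; rewrite -subr_eq0; apply/eqP.
apply: (@roots_geq_poly_eq0 _ _ (codom x)).
- apply/allP => _ /codomP [k ->]; rewrite rootE hornerD hornerN horner_sum.
  rewrite (bigD1 k) //= [X in _ - (_ + X)]big1 => [|j jk].
    rewrite addr0 hornerZ horner_prod big1 ?mulr1 ?subrr // => j jk.
    rewrite hornerZ hornerXsubC mulVf // subr_eq0.
    by apply: contra jk => /eqP/xinj ->.
  rewrite hornerZ horner_prod (bigD1 k) /= 1?eq_sym // hornerZ hornerXsubC.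
  by rewrite subrr mulr0 mul0r mulr0.
- by rewrite /codom map_inj_uniq ?enum_uniq.
rewrite size_codom card_ord (leq_trans (size_polyD _ _)) // geq_max sm size_polyN.
apply: (leq_trans (size_sum _ _ _)); apply/bigmax_leqP => k _.
apply: (leq_trans (size_scale_leq _ _)); apply: leq_trans (size_prod_leq _ _) _.
rewrite leq_subLR.
apply: (@leq_trans (\sum_(j < m | j != k) 2).+1).
  rewrite ltnS; apply: leq_sum => j _.
  by apply: (leq_trans (size_scale_leq _ _)); rewrite size_XsubC.
rewrite sum_nat_const muln2 -addnn cardC1 card_ord.
by rewrite -addnS leq_add2l; case: (m) k => [[]|].
Qed.

(** To the right of all nodes, the [k]-th Lagrange basis polynomial has sign [(-1) ^+ k]: exactly
    the [k] factors [x k - x j] with [j < k] are negative. *)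
Lemma alternating_extrapolation m (x : 'I_m -> R) s (y : R) :
  (forall j k : 'I_m, (j < k)%N -> x k < x j) -> (forall k, x k < y) ->
  (size s <= m)%N -> (forall k : 'I_m, (-1) ^+ k * s.[x k] <= 0) -> s.[y] <= 0.
Proof.
move=> xdec xy sm sgn.
have xinj : injective x.
  move=> j k e; apply: ord_inj; case: (ltngtP j k) => // /xdec; first by rewrite e ltxx.
  by rewrite e ltxx.
rewrite (lagrange_interp xinj sm) horner_sum; apply: sumr_le0 => k _.
rewrite hornerZ horner_prod.
have -> : \prod_(j | j != k) ((x k - x j)^-1 *: ('X - (x j)%:P)).[y]
  = (-1) ^+ k * \prod_(j | j != k) (`|x k - x j|^-1 * (y - x j)).
  have -> : (-1) ^+ k = \prod_(j < m | j != k) (if (j < k)%N then -1 else 1) :> R.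
    rewrite -big_mkcondr prodr_const /= -[in LHS](card_ord k); congr (_ ^+ _).
    rewrite -(card_imset _ (f := widen_ord (ltnW (ltn_ord k)))).
      apply: eq_card => j; rewrite [RHS]unfold_in; apply/imsetP/andP => [[i _ ->] /=|[_ jk]].
        by rewrite ltn_ord -val_eqE /= neq_ltn ltn_ord.
      by exists (Ordinal jk) => //; apply: ord_inj.
    by move=> i j /(congr1 val) /= /ord_inj.
  rewrite -big_split; apply: eq_bigr => j jk /=.
  rewrite hornerZ hornerXsubC; case: ltngtP => jk'.
  - by rewrite ltr0_norm ?subr_lt0 ?xdec // invrN mulN1r mulNr opprK.
  - by rewrite gtr0_norm ?subr_gt0 ?xdec // mul1r.
  by case/eqP: jk; apply: ord_inj.
rewrite mulrA [_ * (-1) ^+ _]mulrC mulr_le0_ge0 // prodr_ge0 // => j jk.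
by rewrite mulr_ge0 ?invr_ge0 ?normr_ge0 // subr_ge0 ltW.
Qed.

(** Two consecutive Chebyshev polynomials of the first kind, which makes the two-term recurrence
    structural. *)
Fixpoint cheb2 n : {poly R} * {poly R} :=
  if n is k.+1 then ((cheb2 k).2, 2 *: ('X * (cheb2 k).2) - (cheb2 k).1) else (1, 'X).
Definition cheb n := (cheb2 n).1.

Lemma chebSS n : cheb n.+2 = 2 *: ('X * cheb n.+1) - cheb n.
Proof. by []. Qed.

Lemma nat_ind2 (P : nat -> Prop) : P 0%N -> P 1%N ->
  (forall n, P n -> P n.+1 -> P n.+2) -> forall n, P n.
Proof.
by move=> P0 P1 PS n; suff [] : P n /\ P n.+1 by []; elim: n => [|n []]; split=> //; apply: PS.
Qed.

Lemma cheb_cos n t : (cheb n).[cos t] = cos (n%:R * t).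
Proof.
elim/nat_ind2: n => [||n IH0 IH1]; rewrite ?mul0r ?cos0 ?hornerC ?mul1r ?hornerX //.
rewrite chebSS hornerD hornerN hornerZ hornerM hornerX IH0 IH1.
have -> : n.+2%:R * t = n.+1%:R * t + t by rewrite -[n.+2]addn1 natrD mulrDl mul1r.
have -> : n%:R * t = n.+1%:R * t - t by rewrite -[n.+1]addn1 natrD mulrDl mul1r addrK.
rewrite !cosD cosN sinN; ring.
Qed.

Lemma size_cheb n : (size (cheb n) <= n.+1)%N.
Proof.
elim/nat_ind2: n => [||n IH0 IH1]; rewrite ?size_poly1 ?size_polyX // chebSS.
rewrite (leq_trans (size_polyD _ _)) // geq_max size_polyN (leq_trans IH0) ?andbT; last lia.
apply: (leq_trans (size_scale_leq _ _)).
by rewrite (leq_trans (size_polyMleq _ _)) // size_polyX.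
Qed.

Lemma cheb1 n : (cheb n).[1] = 1.
Proof. by rewrite -[in X in _.[X]]cos0 cheb_cos mulr0 cos0. Qed.

Lemma deriv_cheb1 n : (cheb n)^`().[1] = n%:R ^+ 2.
Proof.
elim/nat_ind2: n => [||n IH0 IH1].
- by rewrite derivC hornerC expr0n.
- by rewrite derivX hornerC expr1n.
rewrite chebSS derivB derivZ derivM derivX mul1r hornerD hornerN hornerZ hornerD.
rewrite hornerM hornerX mul1r IH0 IH1 cheb1 -[n.+2]addn2 -[n.+1]addn1 !natrD; ring.
Qed.

(* Markov's inequality at an endpoint, by comparison with the Chebyshev
   polynomial at its extremal points. *)
Lemma markov_endpoint D p : (size p <= D.+1)%N ->
  (forall t, -1 <= t <= 1 -> 0 <= p.[t] <= 1) -> p.[1] = 0 ->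
  - p^`().[1] <= D%:R ^+ 2 / 2.
Proof.
case: D => [|D] sp p01 p1.
  by rewrite (size1_polyC sp) derivC hornerC oppr0 expr0n mul0r.
set d := D.+1 in sp *.
pose r := 2^-1 *: (1 - cheb d) - p.
have r1 : r.[1] = 0 by rewrite !hornerE cheb1 p1 subrr mulr0 subr0.
have /factor_theorem [s rs] : root r 1 by rewrite rootE r1.
have sr : (size r <= d.+1)%N.
  rewrite (leq_trans (size_polyD _ _)) // geq_max size_polyN sp andbT.
  apply: (leq_trans (size_scale_leq _ _)).
  by rewrite (leq_trans (size_polyD _ _)) // geq_max size_polyN size_poly1 size_cheb.
have ss : (size s <= d)%N.
  have [->|s0] := eqVneq s 0; first by rewrite size_poly0.
  by move: sr; rewrite rs size_Mmonic ?monicXsubC // size_XsubC addn2.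
suff : s.[1] <= 0.
  have -> : s.[1] = r^`().[1].
    by rewrite rs derivM derivXsubC hornerD !hornerM hornerXsubC subrr mulr0 add0r hornerC mulr1.
  rewrite derivB derivZ derivB derivC hornerD hornerN hornerZ hornerD hornerN hornerC deriv_cheb1.
  lra.
(* The [d] extremal points of [cheb d] other than 1, in decreasing order. *)
pose x (k : 'I_d) : R := cos (k.+1%:R * (pi / d%:R)).
have dpos : 0 < d%:R :> R by rewrite ltr0n.
have arg (k : nat) : (k <= d)%N -> k%:R * (pi / d%:R) \in `[0, pi : R].
  move=> kd; rewrite in_itv /= mulr_ge0 ?divr_ge0 ?pi_ge0 // ?ler0n //=.
  by rewrite mulrCA ger_pMr ?pi_gt0 // ler_pdivrMr // mul1r ler_nat.
have xdec (j k : 'I_d) : (j < k)%N -> x k < x j.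
  move=> jk; rewrite ltr_cos ?arg // ltr_pM2r ?divr_gt0 ?pi_gt0 // ltr_nat.
  by rewrite ltnS.
have x1 k : x k < 1.
  rewrite -cos0 ltr_cos ?arg //; last by rewrite in_itv /= lexx pi_ge0.
  by rewrite mulr_gt0 ?divr_gt0 ?pi_gt0 ?ltr0n.
apply: (alternating_extrapolation xdec x1 ss) => k.
have /andP[p0 p1'] : 0 <= p.[x k] <= 1 by apply: p01; rewrite cos_geN1 cos_le1.
have : r.[x k] = s.[x k] * (x k - 1) by rewrite rs hornerM hornerXsubC.
have ck : (cheb d).[x k] = (-1) ^+ k.+1.
  rewrite /x cheb_cos mulrCA [d%:R * _]mulrC divfK ?gt_eqF //.
  elim: (k.+1) => [|j IH]; first by rewrite mul0r cos0.
  by rewrite -[j.+1]addn1 natrD mulrDl mul1r cosDpi IH addn1 exprS mulN1r.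
rewrite !hornerE ck => e.
have xk1 : x k - 1 < 0 by rewrite subr_lt0.
rewrite -signr_odd; move: e; rewrite exprS mulN1r opprK -signr_odd.
case: (odd k); rewrite /= ?expr1 ?expr0 => e.
  rewrite mulN1r oppr_le0 -(nmulr_rle0 _ xk1) mulrC -e; lra.
by rewrite mul1r -(nmulr_rge0 _ xk1) mulrC -e; lra.
Qed.

(** The substitution [(1 - t) / 2] carries [[-1, 1]] to [[0, 1]] and 1 to 0, and multiplies the
    derivative by [-1/2]. *)
Lemma markov_endpoint01 D p : (size p <= D.+1)%N ->
  (forall t, 0 <= t <= 1 -> 0 <= p.[t] <= 1) -> p.[0] = 0 ->
  p^`().[0] <= D%:R ^+ 2.
Proof.
move=> sp p01 p0.
pose l : {poly R} := 2^-1 *: (1 - 'X).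
have sl : (size l <= 2)%N.
  apply: (leq_trans (size_scale_leq _ _)).
  by rewrite (leq_trans (size_polyD _ _)) // geq_max size_polyN size_poly1 size_polyX.
have lE t : l.[t] = (1 - t) / 2 by rewrite !hornerE mulrC.
have := @markov_endpoint D (p \Po l).
have l1 : l^`().[1] = - 2^-1 by rewrite derivZ derivB derivX derivC sub0r hornerZ hornerN hornerC mulrN1.
rewrite deriv_comp hornerM !horner_comp !lE subrr mul0r l1 => H.
suff: - (p^`().[0] * - 2^-1) <= D%:R ^+ 2 / 2 by rewrite mulrN opprK ler_pM2r ?invr_gt0 ?ltr0n.
apply: H => //.
  apply: leq_trans (size_comp_poly_leq _ _) _; rewrite ltnS.
  apply: (@leq_trans ((size p).-1 * 1)%N).
    by rewrite leq_mul // -subn1 leq_subLR.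
  by rewrite muln1; case: (size p) sp.
by move=> t t1; rewrite horner_comp; apply: p01; rewrite lE; lra.
Qed.

End Markov.

(** * Real polynomials in Boolean variables, as functions of sets *)

Section DegLe.
Variable R : realType.
Implicit Types (I : finType).

(** Sets stand for their indicator vectors, and [c] lists the coefficients of the multilinear
    polynomial representing [G]. *)
Definition deg_le I d (G : {set I} -> R) : Prop := exists2 c : {set I} -> R,
  forall T : {set I}, (d < #|T|)%N -> c T = 0 &
  forall Y, G Y = \sum_(T : {set I} | T \subset Y) c T.

Lemma eq_deg_le I d (G G' : {set I} -> R) : G =1 G' -> deg_le d G -> deg_le d G'.
Proof. by move=> e [c c0 cG]; exists c => // Y; rewrite -e. Qed.

Lemma deg_leW I d d' (G : {set I} -> R) : (d <= d')%N -> deg_le d G -> deg_le d' G.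
Proof. by move=> dd [c c0 cG]; exists c => // T /(leq_ltn_trans dd)/c0. Qed.

Lemma deg_le_cst I (a : R) : deg_le 0 (fun _ : {set I} => a).
Proof.
exists (fun T => if T == set0 then a else 0) => [T|Y].
  by rewrite card_gt0 => /negPf ->.
by rewrite -big_mkcondr (big_pred1 set0) // => T; rewrite andb_idl // => /eqP ->; rewrite sub0set.
Qed.

Lemma deg_leD I d (G G' : {set I} -> R) : deg_le d G -> deg_le d G' ->
  deg_le d (fun Y => G Y + G' Y).
Proof.
move=> [c c0 cG] [c' c'0 cG']; exists (fun T => c T + c' T) => [T dT|Y].
  by rewrite c0 ?c'0 ?addr0.
by rewrite big_split cG cG'.
Qed.

Lemma deg_le_sum I (K : finType) d (G : K -> {set I} -> R) : (forall k, deg_le d (G k)) ->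
  deg_le d (fun Y => \sum_k G k Y).
Proof.
move=> dG; rewrite /index_enum; elim: (Finite.enum _) => [|k r IH].
  apply: (@eq_deg_le _ _ (fun=> 0)) (deg_leW (leq0n _) (deg_le_cst _ 0)) => Y.
  by rewrite big_nil.
by apply: (eq_deg_le _ (deg_leD (dG k) IH)) => Y; rewrite big_cons.
Qed.

Lemma deg_leM I d d' (G G' : {set I} -> R) : deg_le d G -> deg_le d' G' ->
  deg_le (d + d') (fun Y => G Y * G' Y).
Proof.
move=> [c c0 cG] [c' c'0 cG'].
exists (fun T => \sum_(p : {set I} * {set I} | p.1 :|: p.2 == T) c p.1 * c' p.2).
  move=> T dT; rewrite big1 // => -[A B] /= /eqP AB.
  case: (leqP #|A| d) => [dA|/c0 ->]; last by rewrite mul0r.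
  rewrite c'0 ?mulr0 // -(ltn_add2l d) (leq_trans dT) // -AB.
  by rewrite (leq_trans (leq_card_setU _ _)) // leq_add2r.
move=> Y; rewrite cG cG' big_distrlr /= pair_big /=.
rewrite (partition_big (fun p : {set I} * {set I} => p.1 :|: p.2) (fun T => T \subset Y)) /=.
  apply: eq_bigr => T TY; apply: eq_bigl => -[A B] /=; rewrite -subUset andb_idl //.
  by move/eqP ->.
by move=> -[A B]; rewrite -subUset.
Qed.

Lemma deg_le_prod I (K : finType) (A : {set K}) d (G : K -> {set I} -> R) :
  (forall k, deg_le d (G k)) -> deg_le (#|A| * d) (fun Y => \prod_(k in A) G k Y).
Proof.
move=> dG; elim/set_ind1: A => [|h A hA IH].
  apply: eq_deg_le (deg_leW (leq0n _) (deg_le_cst _ 1)) => Y.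
  by rewrite big_set0.
rewrite cardsU1 hA mulSn; apply: eq_deg_le (deg_leM (dG h) IH) => Y.
by rewrite big_setU1.
Qed.

(** Injectivity on [A] means that each variable of [G] is replaced by a single new variable or by 0,
    which cannot raise the degree. *)
Lemma deg_le_pull I I' (A : {set I'}) (l : I' -> I) d (G : {set I} -> R) :
  {in A &, injective l} -> deg_le d G -> deg_le d (fun Y => G (l @: (Y :&: A))).
Proof.
move=> linj [c c0 cG]; exists (fun T : {set I'} => if T \subset A then c (l @: T) else 0) => [T dT|Y].
  case: ifP => // TA; rewrite c0 // card_in_imset // => a b /(subsetP TA) aA /(subsetP TA) bA.
  exact: linj.
rewrite cG -big_mkcondr /=.
rewrite (reindex_onto (fun T : {set I'} => l @: T) (fun T => (l @^-1: T) :&: (Y :&: A))) /=.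
  apply: eq_bigl => T; rewrite -subsetI; apply/andP/idP => [[s /eqP <-]|s].
    exact: subsetIr.
  split; first exact: imsetS.
  apply/eqP/setP => a; rewrite !inE; apply/and3P/idP => [[aT aY aA]|aT].
    case/imsetP: aT => b bT e; have bA : b \in A by have := subsetP s b bT; rewrite inE => /andP[].
    by rewrite (linj _ _ aA bA e).
  by have := subsetP s a aT; rewrite inE => /andP[-> ->]; rewrite imset_f.
move=> T s; apply/setP => b; apply/imsetP/idP => [[a]|bT].
  by rewrite !inE => /and3P[aT _ _ ->].
have /imsetP [a aYA e] := subsetP s b bT.
by exists a => //; rewrite inE aYA inE -e bT.
Qed.

(** For [v] with values in [[0, 1]], the mean of [G] at a random set containing each [i]
    independently with probability [v i]. *)
Definition multilinear_ext I (v : I -> R) (G : {set I} -> R) : R :=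
  \sum_(B : {set I}) G B * \prod_i (if i \in B then v i else 1 - v i).

Lemma multilinear_ext_mono I (v : I -> R) (T : {set I}) :
  multilinear_ext v (fun B => (T \subset B)%:R) = \prod_(i in T) v i.
Proof.
rewrite big_mkcond /=.
rewrite (eq_bigr (fun i => v i + (if i \in T then 0 else 1 - v i))); last first.
  by move=> i _; case: ifP => _; rewrite ?addr0 // addrC subrK.
rewrite bigA_distr; apply: eq_bigr => B _.
case: (boolP (T \subset B)) => [TB|/subsetPn [i iT iB]].
  rewrite mul1r; apply: eq_bigr => i _; case: ifP => // iB.
  by case: ifP => // /(subsetP TB); rewrite iB.
by rewrite mul0r (bigD1 i) //= (negPf iB) iT mul0r.
Qed.

Lemma multilinear_ext_expand I (v : I -> R) (G c : {set I} -> R) :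
  (forall Y, G Y = \sum_(T : {set I} | T \subset Y) c T) ->
  multilinear_ext v G = \sum_T c T * \prod_(i in T) v i.
Proof.
move=> cG; under [RHS]eq_bigr => T _ do rewrite -multilinear_ext_mono mulr_sumr.
rewrite exchange_big /=; apply: eq_bigr => B _.
rewrite cG mulr_suml big_mkcond /=; apply: eq_bigr => T _.
by case: ifP => _; rewrite ?mul1r // mul0r mulr0.
Qed.

Lemma multilinear_ext01 I (v : I -> R) (G : {set I} -> R) : (forall i, 0 <= v i <= 1) ->
  (forall Y, 0 <= G Y <= 1) -> 0 <= multilinear_ext v G <= 1.
Proof.
move=> v01 G01; have p0 (B : {set I}) : 0 <= \prod_i (if i \in B then v i else 1 - v i).
  apply: prodr_ge0 => i _; have := v01 i; case: ifP => _; lra.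
apply/andP; split.
  by apply: sumr_ge0 => B _; rewrite mulr_ge0 //; case/andP: (G01 B).
have := multilinear_ext_mono v set0; rewrite big_set0 => <-; apply: ler_sum => B _.
by rewrite sub0set ler_wpM2r //; case/andP: (G01 B).
Qed.

Lemma multilinear_ext_vertex I (v : I -> R) (G : {set I} -> R) (B : {set I}) :
  (forall i, v i = (i \in B)%:R) -> multilinear_ext v G = G B.
Proof.
move=> vB; have pB : \prod_i (if i \in B then v i else 1 - v i) = 1.
  by apply: big1 => i _; rewrite vB; case: (i \in B); rewrite ?subr0.
rewrite /multilinear_ext (bigD1 B) //= pB mulr1 [X in _ + X]big1 ?addr0 // => A AB.
have /existsP [i ni] : [exists i, (i \in A) != (i \in B)].
  apply: contraNT AB => /existsPn e; apply/eqP/setP => i; apply/eqP.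
  by have := e i; rewrite negbK.
rewrite (bigD1 i) //= vB; move: ni; case: (i \in A); case: (i \in B) => //= _.
  by rewrite mul0r mulr0.
by rewrite subrr mul0r mulr0.
Qed.

(* A bounded polynomial of degree [D] in Boolean variables that vanishes at the
   origin and equals 1 at [s] of its neighbours. *)
Definition sensitive_poly (s D : nat) : Prop :=
  exists (I : finType) (G : {set I} -> R) (J : {set I}),
    [/\ deg_le D G, forall Y, 0 <= G Y <= 1, G set0 = 0,
        forall b, b \in J -> G [set b] = 1 & #|J| = s].

(** Along the diagonal the multilinear extension is a univariate polynomial of degree at most [D],
    bounded in [[0, 1]], whose derivative at 0 is the sum of [G [set b]], hence at least [s].
    Markov's inequality bounds that derivative. *)
Lemma sensitive_poly_bound s D : sensitive_poly s D -> s%:R <= D%:R ^+ 2 :> R.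
Proof.
move=> [I [G [J [[c c0 cG] G01 G0 GJ <-]]]].
pose P : {poly R} := \sum_T c T *: 'X^#|T|.
have PE t : P.[t] = multilinear_ext (fun=> t) G.
  rewrite (multilinear_ext_expand _ cG) horner_sum; apply: eq_bigr => T _.
  by rewrite hornerZ hornerXn prodr_const.
have cset0 : c set0 = 0.
  by rewrite -G0 cG (big_pred1 set0) // => T; rewrite subset0.
have cset1 b : c [set b] = G [set b].
  rewrite cG (bigD1 [set b]) //= big1 ?addr0 // => T /andP[].
  by rewrite subset1 => /orP[->|/eqP -> _].
have sP : (size P <= D.+1)%N.
  apply: (leq_trans (size_sum _ _ _)); apply/bigmax_leqP => T _.
  case: (leqP #|T| D) => [dT|/c0 ->]; last by rewrite scale0r size_poly0.
  by apply: (leq_trans (size_scale_leq _ _)); rewrite size_polyXn.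
have P0 : P.[0] = 0.
  rewrite PE (@multilinear_ext_vertex _ _ _ set0) // => i; by rewrite inE.
have := markov_endpoint01 sP _ P0.
rewrite -[P^`()]/(P^`()) horner_coef0 coef_deriv mulr1n => H.
apply: le_trans (H _) => [|t t01]; last by rewrite PE; apply: multilinear_ext01.
rewrite coef_sum (eq_bigr (fun T : {set I} => if #|T| == 1%N then c T else 0)); last first.
  by move=> T _; rewrite coefZ coefXn eq_sym; case: eqP; rewrite ?mulr1 ?mulr0.
rewrite -big_mkcond /= (eq_bigl (fun T : {set I} => T \in [set [set b] | b in [set: I]])); last first.
  by move=> T; apply/cards1P/imsetP => [[b ->]|[b _ ->]]; exists b.
rewrite big_imset; last by move=> a b _ _ /set1_inj.
rewrite [leRHS](bigID (mem J)) /= -sum1_card natr_sum -[leLHS]addr0 lerD //.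
  rewrite [leRHS](eq_bigl (mem J)) => [|b]; last by rewrite !inE.
  by apply: ler_sum => b bJ; rewrite cset1 GJ.
by apply: sumr_ge0 => b _; rewrite cset1; case/andP: (G01 [set b]).
Qed.

Lemma sum_sign I (Y : {set I}) :
  \sum_(T : {set I} | T \subset Y) (-1) ^+ #|T| = (Y == set0)%:R :> R.
Proof.
elim/set_ind1: Y => [|h A hA _].
  by rewrite (big_pred1 set0) ?cards0 ?eqxx // => T; rewrite subset0.
rewrite big_subsetU1 // big1 => [|T TA].
  by case: eqP => // /setP /(_ h); rewrite !inE eqxx.
have hT : h \notin T by apply: contra hA; apply: (subsetP TA).
by rewrite cardsU1 hT exprS mulN1r subrr.
Qed.

(** The OR of [N] variables, expanded by inclusion-exclusion, is the seed of the iteration in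
    [frac_packing]. *)
Lemma sensitive_poly_or N : sensitive_poly N N.
Proof.
exists 'I_N, (fun Y => (Y != set0)%:R), setT; split.
- exists (fun T => (T == set0)%:R - (-1) ^+ #|T|) => [T|Y].
    by rewrite ltnNge -[X in (_ <= X)%N]card_ord max_card.
  rewrite big_split /= sumrN sum_sign.
  rewrite (bigD1 set0) ?sub0set //= eqxx big1 => [|T /andP[_ /negPf ->] //].
  by rewrite addr0; case: eqP; rewrite ?subrr ?subr0.
- by move=> Y; case: eqP; rewrite ?lexx ?ler01.
- by rewrite eqxx.
- move=> b _; case: eqP => // /setP /(_ b); by rewrite !inE eqxx.
by rewrite cardsT card_ord.
Qed.

End DegLe.

(** * Fractional packings of active sets *)

Section Packing.
Variables (R : realType) (n : nat).
Implicit Types (f : boolfun n) (x : cube n) (S T B : {set 'I_n}).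

Notation bder f := (der (fun y => (f y)%:R : R)).

Lemma deg_le_flip f x D : (forall T, (D < #|T|)%N -> bder f T x = 0) ->
  deg_le D (fun B : {set 'I_n} => (f (flip x B) != f x)%:R : R).
Proof.
move=> dD; exists (fun T => (-1) ^+ #|T| * der (fun y => (f y != f x)%:R : R) T x); last first.
  by move=> B; rewrite -der_mobius.
move=> T DT; suff -> : der (fun y => (f y != f x)%:R : R) T x = 0 by rewrite mulr0.
have /card_gt0P [i iT] : (0 < #|T|)%N by apply: leq_trans DT.
case fx: (f x); last first.
  by rewrite -[RHS](dD T DT); apply: eq_bigr => U _; congr (_ * _ %:R); case: (f _).
have d1 : der (fun=> 1 : R) T x = 0 by apply: (@der_indep R n _ i).
rewrite -[RHS]subr0 -{1}d1 -(dD T DT) /der -sumrB; apply: eq_bigr => U _.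
by rewrite -mulrBr; congr (_ * _); case: (f _); rewrite ?subrr ?subr0.
Qed.

Lemma inj_into (K L : finType) (A : {set K}) (J : {set L}) : (0 < #|J|)%N -> (#|A| <= #|J|)%N ->
  exists2 l : K -> L, {in A &, injective l} & forall a, a \in A -> l a \in J.
Proof.
move=> /card_gt0P [b0 b0J] AJ; exists (fun a => nth b0 (enum J) (index a (enum A))).
  have lt c : c \in A -> (index c (enum A) < size (enum J))%N.
    by move=> cA; rewrite -cardE (leq_trans _ AJ) // cardE index_mem mem_enum.
  move=> c d cA dA /eqP; rewrite nth_uniq ?enum_uniq ?lt // => /eqP e.
  have cE : c \in enum A by rewrite mem_enum.
  have dE : d \in enum A by rewrite mem_enum.
  by rewrite -(nth_index c cE) e (nth_index c dE).
move=> c cA; have : nth b0 (enum J) (index c (enum A)) \in enum J.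
  by rewrite mem_nth // -cardE (leq_trans _ AJ) // cardE index_mem mem_enum.
by rewrite mem_enum.
Qed.

(* Substituting [G], which has [s] sensitive directions, for every variable of
   [f] turns a fractional packing of sensitive blocks with denominator [s] into
   genuine sensitive directions. *)
Lemma sensitive_poly_comp f x D (B : {set 'I_n} -> {set 'I_n}) (m : {set 'I_n} -> nat) s D0 :
  (forall T, (D < #|T|)%N -> bder f T x = 0) ->
  (forall S, (0 < m S)%N -> S != set0 /\ (B S \subset S /\ f (flip x (B S)) != f x)) ->
  (forall i, (\sum_(S : {set 'I_n} | i \in S) m S <= s)%N) ->
  (0 < s)%N -> sensitive_poly R s D0 -> sensitive_poly R (\sum_S m S) (D * D0).
Proof.
move=> dD mB load s0 [I [G [J [dG G01 G0 GJ cJ]]]].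
(* [J'] holds [m S] copies of every block [S]. The copies touching [i], at most [s] of them, are
   sent injectively by [l i] to sensitive directions of [G]; switching on one copy of [S] thus sets
   exactly the variables of [B S] to 1. *)
pose I' : finType := ({set 'I_n} * 'I_s)%type.
pose J' : {set I'} := [set c : I' | (c.2 < m c.1)%N].
pose A (i : 'I_n) : {set I'} := [set c in J' | i \in B c.1].
have ms S : (m S <= s)%N.
  case: (posnP (m S)) => [-> //|/mB [/set0Pn [i iS] _]].
  by apply: leq_trans (load i); rewrite (bigD1 S) //= leq_addr.
have countm (P : pred {set 'I_n}) : #|[set c in J' | P c.1]| = (\sum_(S | P S) m S)%N.
  rewrite -sum1_card (eq_bigl (fun c : I' => P c.1 && (c.2 < m c.1)%N)); last first.
    by move=> c; rewrite !inE andbC.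
  rewrite -(pair_big_dep (fun S => P S) (fun S (k : 'I_s) => (k < m S)%N) (fun _ _ => 1%N)) /=.
  by apply: eq_bigr => S _; rewrite -(big_ord_widen _ (fun=> 1%N) (ms S)) sum1_card card_ord.
have cA i : (#|A i| <= #|J|)%N.
  rewrite cJ; apply: leq_trans (load i).
  rewrite -(countm (fun S => i \in S)); apply: subset_leq_card; apply/subsetP => c.
  rewrite !inE => /andP[cm iB]; rewrite cm /=.
  by have [_ [/subsetP BS _]] := mB _ (leq_ltn_trans (leq0n _) cm); apply: BS.
have /choice [l lP] i : exists l : I' -> I, {in A i &, injective l} /\ forall a, a \in A i -> l a \in J.
  have J0 : (0 < #|J|)%N by rewrite cJ.
  by have [l l1 l2] := inj_into J0 (cA i); exists l.
pose v (Y : {set I'}) i := G (l i @: (Y :&: A i)).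
pose Gf (C : {set 'I_n}) : R := (f (flip x C) != f x)%:R.
exists I', (fun Y => multilinear_ext (v Y) Gf), J'; split.
- have [c c0 cGf] := deg_le_flip dD.
  apply: (@eq_deg_le _ _ _ (fun Y => \sum_T c T * \prod_(i in T) v Y i)).
    by move=> Y; rewrite (multilinear_ext_expand _ cGf).
  apply: deg_le_sum => T; case: (leqP #|T| D) => [TD|/c0 ->]; last first.
    apply: eq_deg_le (deg_leW (leq0n _) (deg_le_cst _ 0)) => Y; by rewrite mul0r.
  have dT : deg_le (#|T| * D0) (fun Y => \prod_(i in T) v Y i).
    by apply: deg_le_prod => i; apply: deg_le_pull => //; case: (lP i).
  apply: deg_leW (deg_leM (deg_le_cst _ (c T)) dT).
  by rewrite add0n leq_mul2r TD orbT.
- move=> Y; apply: multilinear_ext01 => [i|C]; first exact: G01.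
  by rewrite /Gf; case: (_ != _); rewrite ?lexx ?ler01.
- rewrite (@multilinear_ext_vertex _ _ _ _ set0) => [|i]; first by rewrite /Gf flip0 eqxx.
  by rewrite /v set0I imset0 G0 inE.
- move=> c cJ'; rewrite (@multilinear_ext_vertex _ _ _ _ (B c.1)) => [|i].
    have cm : (0 < m c.1)%N by move: cJ'; rewrite inE; apply: leq_ltn_trans.
    by rewrite /Gf; have [_ [_ ->]] := mB _ cm.
  rewrite /v; case: (boolP (i \in B c.1)) => iB.
    have cAi : c \in A i by rewrite inE cJ'.
    rewrite (setIidPl _) ?sub1set // imset_set1 GJ //.
    by case: (lP i) => _; apply.
  suff -> : [set c] :&: A i = set0 by rewrite imset0.
  by apply/setP => c'; rewrite !inE; case: eqP => // ->; rewrite (negPf iB) andbF.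
by rewrite -(countm predT); apply: eq_card => c; rewrite !inE andbT.
Qed.

Lemma expr_unbounded (q b : R) : 1 < q -> exists k, b < q ^+ k.
Proof.
move=> q1; have e0 : 0 < q - 1 by rewrite subr_gt0.
have bern_ineq k : 1 + k%:R * (q - 1) <= q ^+ k.
  elim: k => [|k IH]; first by rewrite mul0r addr0.
  have kk : 0 <= k%:R * (q - 1) * (q - 1) by rewrite !mulr_ge0 ?ler0n // ltW.
  rewrite exprS -natr1; apply: le_trans (_ : q * (1 + k%:R * (q - 1)) <= _); first by nra.
  by rewrite ler_pM2l // (lt_trans _ q1).
exists (Num.truncn (`|b| / (q - 1))).+1; apply: lt_le_trans (bern_ineq _).
have /truncn_itv /andP[_ H] : 0 <= `|b| / (q - 1) by rewrite divr_ge0 ?normr_ge0 ?ltW.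
rewrite ltr_pdivrMr // in H; apply: le_lt_trans (ler_norm b) _.
by apply: lt_le_trans H _; rewrite lerDr.
Qed.

(* If the packing were larger than [D ^ 2], iterated composition would yield
   functions whose sensitivity at a point exceeds the square of their degree. *)
Lemma frac_packing f x D (Y : {set 'I_n} -> R) :
  (forall T, (D < #|T|)%N -> bder f T x = 0) ->
  (forall S, 0 <= Y S) ->
  (forall S, Y S != 0 -> S != set0 /\ bder f S x != 0) ->
  (forall i, \sum_(S : {set 'I_n} | i \in S) Y S <= 1) ->
  \sum_S Y S <= D%:R ^+ 2.
Proof.
move=> dD Y0 Yact load; rewrite leNgt; apply/negP => KD.
set K := \sum_S Y S in KD.
case: (posnP D) => [D0|Dpos].
  move: KD; rewrite D0 expr0n /K big1 ?ltxx // => S _; apply/eqP; apply: contraT => /Yact [S0 /eqP[]].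
  by apply: dD; rewrite D0 card_gt0.
have D1 : 1 <= D%:R :> R by rewrite ler1n.
have DD1 : 1 <= D%:R ^+ 2 :> R by rewrite exprn_ege1.
have K1 : 1 < K by apply: le_lt_trans KD.
have /choice [B BP] S : exists B : {set 'I_n}, Y S != 0 ->
    S != set0 /\ (B \subset S /\ f (flip x B) != f x).
  case: (boolP (Y S == 0)) => [_|/Yact [S0 dS]]; first by exists set0.
  by have [U US fU] := bder_sens S0 dS; exists U.
pose m s S := Num.truncn (s%:R * Y S).
have mP s S : (m s S)%:R <= s%:R * Y S < (m s S).+1%:R.
  by apply: truncn_itv; rewrite mulr_ge0 ?ler0n.
have step s D0 : (0 < s)%N -> sensitive_poly R s D0 -> sensitive_poly R (\sum_S m s S) (D * D0).
  move=> s0; apply: (@sensitive_poly_comp f x D B) => //.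
    move=> S mS; apply: BP; apply: contraTN mS => /eqP YS.
    by rewrite -leqNgt /m YS mulr0 truncn0.
  move=> i; rewrite -(ler_nat R) natr_sum.
  apply: (@le_trans _ _ (s%:R * \sum_(S : {set 'I_n} | i \in S) Y S)).
    by rewrite mulr_sumr; apply: ler_sum => S _; case/andP: (mP s S).
  by rewrite ger_pMr ?ltr0n.
(* Rounding down loses at most 1 per set, so one composition turns [s] into at least [K * s - b];
   [a] is the fixed point of this map, and [s - a] grows by the factor [K]. *)
pose b : R := #|{: {set 'I_n}}|%:R; pose a := b / (K - 1).
have K10 : 0 < K - 1 by rewrite subr_gt0.
have a0 : 0 <= a by rewrite divr_ge0 ?ler0n ?ltW.
have aE : a * (K - 1) = b by rewrite /a divfK ?gt_eqF.
pose N := (Num.truncn a).+2.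
have aN : 1 <= N%:R - a.
  by have /truncn_itv/andP[_ /ltW] := a0; rewrite lerBrDl -[N%:R]natr1 lerD2r.
have iter k : exists2 s : nat, K ^+ k <= s%:R - a & sensitive_poly R s (D ^ k * N).
  elim: k => [|k [s sK sp]].
    by exists N; rewrite ?expr0 // expn0 mul1n; apply: sensitive_poly_or.
  have s0 : (0 < s)%N.
    rewrite -(ltr_nat R); have : 0 < K ^+ k by rewrite exprn_gt0 // (lt_trans ltr01).
    lra.
  exists (\sum_S m s S)%N; last by rewrite expnS -mulnA; apply: step.
  apply: (@le_trans _ _ (K * (s%:R - a))).
    by rewrite exprS ler_pM2l // (lt_trans ltr01).
  have : K * s%:R - b <= (\sum_S m s S)%:R.
    rewrite natr_sum lerBlDr /b -sum1_card natr_sum -big_split /= mulrC mulr_sumr.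
    by apply: ler_sum => S _; case/andP: (mP s S) => _ /ltW; rewrite natr1.
  rewrite -aE; lra.
(* After [k] compositions [K ^+ k] is at most [s], which is at most the square of the degree
   [D ^ k * N]; this fails once [(K / D ^ 2) ^ k] exceeds [N ^ 2]. *)
have q1 : 1 < K / D%:R ^+ 2 by rewrite ltr_pdivlMr ?mul1r // (lt_le_trans ltr01).
have [k kq] := expr_unbounded (N%:R ^+ 2) q1.
have [s sK sp] := iter k; have := sensitive_poly_bound sp.
rewrite natrM natrX exprMn => sD.
have : K ^+ k <= (D%:R ^+ k) ^+ 2 * N%:R ^+ 2 by lra.
rewrite -exprM mulnC exprM leNgt => /negP; apply.
by rewrite mulrC -ltr_pdivlMr ?exprn_gt0 ?(lt_le_trans ltr01) // -expr_div_n.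
Qed.

End Packing.

(** * Fourier analysis, thinning, and the degree weight for small degree *)

Section Fourier.
Variables (R : realType) (n : nat).
Implicit Types (f : boolfun n) (x : cube n) (S T U : {set 'I_n}) (i h : 'I_n) (G : cube n -> R).

Notation bder f := (der (fun y => (f y)%:R : R)).

Definition chi S x : R := \prod_(i in S) (-1) ^+ x i.
Definition fourier G S : R := avg (fun x => chi S x * G x).

Lemma chi_flip1 S i x : chi S (flip x [set i]) = (if i \in S then -1 else 1) * chi S x.
Proof.
case: ifP => iS.
  rewrite /chi (bigD1 i) //= [X in _ = _ * X](bigD1 i) //= mulrA; congr (_ * _).
    by rewrite ffunE set11; case: (x i); rewrite /= ?expr0 ?expr1 ?mulrNN ?mulN1r ?mulr1.
  by apply: eq_bigr => j /andP[_ ji]; rewrite ffunE inE (negPf ji).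
rewrite mul1r; apply: eq_bigr => j jS; rewrite ffunE inE.
by case: eqP => // e; rewrite e iS in jS.
Qed.

Lemma chi_flip S U x : U \subset S -> chi S (flip x U) = (-1) ^+ #|U| * chi S x.
Proof.
elim/set_ind1: U x => [|h A hA IH] x; first by rewrite flip0 cards0 mul1r.
rewrite subUset sub1set => /andP[hS AS].
by rewrite -flip1U // IH // chi_flip1 hS cardsU1 hA exprS mulrCA mulrA.
Qed.

Lemma sum_chi x y : \sum_S chi S x * chi S y = (x == y)%:R * 2 ^+ n.
Proof.
have -> : \sum_S chi S x * chi S y = \prod_i ((-1) ^+ x i * (-1) ^+ y i + 1).
  rewrite bigA_distr; apply: eq_bigr => S _.
  by rewrite -big_mkcond /= big_split.
case: eqP => [->|/eqP ne].
  rewrite mul1r (eq_bigr (fun=> 2)) ?prodr_const ?card_ord // => i _.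
  by case: (y i); rewrite /= ?expr1 ?expr0 ?mulrNN mulr1.
have /existsP [i ni] : [exists i, x i != y i].
  apply: contraNT ne => /existsPn e; apply/eqP/ffunP => i; apply/eqP.
  by have := e i; rewrite negbK.
rewrite mul0r (bigD1 i) //=; suff -> : (-1) ^+ x i * (-1) ^+ y i + 1 = 0 :> R by rewrite mul0r.
by move: ni; case: (x i); case: (y i) => //= _; rewrite ?expr1 ?expr0 ?mulr1 ?mul1r addNr.
Qed.

Lemma parseval G : \sum_S fourier G S ^+ 2 = avg (fun x => G x ^+ 2).
Proof.
transitivity (\sum_x \sum_y (\sum_S chi S x * chi S y) * (G x * G y) / 4 ^+ n).
  rewrite exchange_big /= [RHS](eq_bigr (fun y => \sum_S \sum_x
     chi S x * chi S y * (G x * G y) / 4 ^+ n)); last first.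
    move=> y _; rewrite exchange_big; apply: eq_bigr => x _ /=.
    by rewrite mulr_suml mulr_suml.
  rewrite [RHS]exchange_big /=; apply: eq_bigr => S _.
  rewrite /fourier /avg expr2 mulrACA -invfM -exprMn -natrM.
  rewrite mulr_suml [LHS]mulr_suml exchange_big /=; apply: eq_bigr => x _.
  rewrite mulr_sumr mulr_suml; apply: eq_bigr => y _; congr (_ / _); ring.
rewrite /avg mulr_suml; apply: eq_bigr => x _.
rewrite (bigD1 x) //= [X in _ + X]big1 => [|y yx]; last by rewrite sum_chi eq_sym (negPf yx) !mul0r.
rewrite addr0 sum_chi eqxx mul1r -expr2.
have -> : 4 ^+ n = 2 ^+ n * 2 ^+ n :> R by rewrite -exprMn -natrM.
by rewrite invfM mulrACA divff ?pow2_neq0 // mul1r.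
Qed.

Definition sgnf f x : R := (-1) ^+ f x.

(** Half the difference between [sgnf f] and its flip keeps exactly the coefficients containing [i],
    and its square is the indicator of sensitivity; Parseval compares the two. *)
Lemma sgnf_influence f i : \sum_(S : {set 'I_n} | i \in S) fourier (sgnf f) S ^+ 2 = influence R f i.
Proof.
pose G x := (sgnf f x - sgnf f (flip x [set i])) / 2.
have GE S : fourier G S = if i \in S then fourier (sgnf f) S else 0.
  have -> : fourier G S = (fourier (sgnf f) S - avg (fun x => chi S x * sgnf f (flip x [set i]))) / 2.
    rewrite /fourier -[X in _ - X]mul1r -mulNr -avgZ -avgD mulrC -avgZ; apply: eq_avg => x.
    rewrite /G; lra.
  rewrite -(avg_flip [set i] (fun x => chi S x * sgnf f (flip x [set i]))).
  rewrite (eq_avg (G := fun x => (if i \in S then -1 else 1) * (chi S x * sgnf f x))); last first.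
    by move=> x; rewrite flipK chi_flip1 mulrA.
  rewrite avgZ; case: ifP => _; rewrite /fourier; lra.
rewrite big_mkcond /= (eq_bigr (fun S => fourier G S ^+ 2)); last first.
  by move=> S _; rewrite GE; case: ifP => // _; rewrite expr0n.
rewrite parseval; apply: eq_avg => x; rewrite /G /sgnf /sbit.
by case: (f x); case: (f _); rewrite /= ?expr1 ?expr0; lra.
Qed.

(** Averaging the coefficient over all flips inside [S] expresses it through the derivative along
    [S], so it vanishes when that derivative does. *)
Lemma fourier_mono f S : S != set0 -> fourier (sgnf f) S != 0 -> mono R f S.
Proof.
move=> /set0Pn [i iS]; apply: contraNT => nm.
have d0 x : bder f S x = 0 by apply/eqP/negPn/negP => d; case/negP: nm; apply/monoP; exists x.
have e : 2 ^+ #|S| * fourier (sgnf f) S = 0.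
  rewrite -natrX -card_powerset mulr_natl -sumr_const.
  rewrite (eq_bigr (fun U : {set 'I_n} => avg (fun x => chi S x * ((-1) ^+ #|U| * sgnf f (flip x U))))); last first.
    move=> U; rewrite inE => US; rewrite /fourier -[LHS](avg_flip U).
    by apply: eq_avg => x; rewrite chi_flip // mulrAC mulrA mulrC mulrA mulrAC.
  rewrite -avg_sum -[RHS](avg_cst n 0); apply: eq_avg => x.
  rewrite -mulr_sumr (eq_bigl (fun U : {set 'I_n} => U \subset S)) => [|U]; last by rewrite inE.
  have -> : \sum_(U : {set 'I_n} | U \subset S) (-1) ^+ #|U| * sgnf f (flip x U)
     = der (fun=> 1) S x - 2 * bder f S x.
    rewrite /der mulr_sumr -sumrB; apply: eq_bigr => U _; rewrite /sgnf.
    by case: (f _); rewrite /= ?expr1 ?expr0; ring.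
  by rewrite d0 (@der_indep R n _ i) // mulr0 subr0 mulr0.
by move/eqP: e; rewrite mulf_eq0 (negPf (pow2_neq0 _ _)).
Qed.

Lemma sum_sgnf2 f : \sum_S fourier (sgnf f) S ^+ 2 = 1.
Proof.
rewrite parseval -[RHS](avg_cst n 1); apply: eq_avg => x.
by rewrite /sgnf -exprM mulnC exprM sqrrN !expr1n.
Qed.

Lemma sum_loads (y : {set 'I_n} -> R) :
  \sum_i \sum_(S : {set 'I_n} | i \in S) y S = \sum_S y S * #|S|%:R.
Proof.
rewrite (exchange_big_dep predT) //=; apply: eq_bigr => S _.
by rewrite sumr_const mulr_natr.
Qed.

(** Total influence is the mean size of a set drawn from the squared Fourier coefficients, which is
    supported on sets of size at most [D]. *)
Lemma sum_influence_le_deg f D : (forall S, mono R f S -> (#|S| <= D)%N) ->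
  \sum_i influence R f i <= D%:R.
Proof.
move=> fD; under eq_bigr => i _ do rewrite -sgnf_influence.
rewrite sum_loads; apply: (@le_trans _ _ (\sum_S fourier (sgnf f) S ^+ 2 * D%:R)); last first.
  by rewrite -mulr_suml sum_sgnf2 mul1r.
apply: ler_sum => S _; have [->|S0] := eqVneq S set0.
  by rewrite cards0 mulr0 mulr_ge0 ?sqr_ge0 ?ler0n.
have [->|/(fourier_mono S0)/fD SD] := eqVneq (fourier (sgnf f) S) 0.
  by rewrite expr0n !mul0r.
by rewrite ler_wpM2l ?sqr_ge0 // ler_nat.
Qed.

Lemma big_setD1U h (F : {set 'I_n} -> R) :
  \sum_S F S = \sum_(S : {set 'I_n} | h \notin S) (F S + F (h |: S)).
Proof.
rewrite (eq_bigl (fun S : {set 'I_n} => S \subset h |: [set~ h])) => [|S]; last first.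
  by rewrite -[[set~ h]]/(~: [set h]) setUCr subsetT.
rewrite big_subsetU1 ?inE ?eqxx //; apply: eq_bigl => S.
by rewrite subsets_disjoint setCK disjoint_sym disjoints1.
Qed.

(** One element [h] is treated at a time: a set containing [h] drops it with probability [1 - t].
    This corrects the load at [h] and leaves the other loads unchanged. *)
Lemma thinning (y : {set 'I_n} -> R) (u : 'I_n -> R) :
  (forall S, 0 <= y S) -> (forall i, 0 <= u i) ->
  (forall i, u i <= \sum_(S : {set 'I_n} | i \in S) y S) ->
  exists z : {set 'I_n} -> R, [/\ forall S, 0 <= z S, \sum_S z S = \sum_S y S,
    forall i, \sum_(S : {set 'I_n} | i \in S) z S = u i
    & forall S, z S != 0 -> exists2 T : {set 'I_n}, S \subset T & y T != 0].
Proof.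
move=> y0 u0 uy.
suff /(_ setT) [z [z0 zs zJ zT]] : forall J : {set 'I_n}, exists z : {set 'I_n} -> R,
  [/\ forall S, 0 <= z S, \sum_S z S = \sum_S y S,
    forall i, \sum_(S : {set 'I_n} | i \in S) z S =
      if i \in J then u i else \sum_(S : {set 'I_n} | i \in S) y S
    & forall S, z S != 0 -> exists2 T : {set 'I_n}, S \subset T & y T != 0].
  by exists z; split=> // i; rewrite zJ inE.
elim/set_ind1 => [|h J hJ [z [z0 zs zJ zT]]].
  by exists y; split=> // [i|S yS]; [rewrite inE|exists S].
have := uy h; have := zJ h; rewrite (negPf hJ) => <-.
set l := \sum_(S : {set 'I_n} | h \in S) z S => ul.
have l0 : 0 <= l by apply: sumr_ge0.
(* If [l = 0] then [u h = 0], and division by zero gives [t = 0], as wanted. *)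
pose t := u h / l.
have t0 : 0 <= t by rewrite divr_ge0.
have t1 : t <= 1.
  have [e|l0'] := eqVneq l 0; first by rewrite /t e invr0 mulr0 ler01.
  by rewrite ler_pdivrMr ?mul1r // lt0r l0'.
have tl : t * l = u h.
  have [e|l0'] := eqVneq l 0; last by rewrite divfK.
  by rewrite e mulr0; apply/eqP; rewrite eq_le u0 -e.
exists (fun S => if h \in S then t * z S else z S + (1 - t) * z (h |: S)).
split=> [S||i|S].
- case: ifP => _; first exact: mulr_ge0.
  by apply: addr_ge0 => //; apply: mulr_ge0 => //; rewrite subr_ge0.
- rewrite -zs [LHS](big_setD1U h) [RHS](big_setD1U h); apply: eq_bigr => S hS.
  by rewrite (negPf hS) setU11; ring.
- rewrite !inE; have [->|ih] /= := eqVneq i h.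
    by rewrite -tl mulr_sumr; apply: eq_bigr => S ->.
  rewrite -zJ big_mkcond [RHS]big_mkcond [LHS](big_setD1U h) [RHS](big_setD1U h).
  apply: eq_bigr => S hS; rewrite (negPf hS) setU11 !inE (negPf ih) /=.
  by case: ifP => _; ring.
case: ifP => hS nz; first by apply: zT; apply: contra_neq nz => ->; rewrite mulr0.
have [e|/zT //] := eqVneq (z S) 0.
have [T ST yT] : exists2 T : {set 'I_n}, h |: S \subset T & y T != 0.
  by apply: zT; apply: contra_neq nz => ->; rewrite e mulr0 addr0.
by exists T => //; apply: subset_trans ST; apply: subsetUr.
Qed.

(** For [k = r + j + 1] this is [j + 1 <= 2 ^ j]. It converts a bound on the mean of [2 ^ |S|] into
    one on the mean of [|S|]. *)
Lemma leq_add_pow k r : k%:R <= r%:R + 2 ^+ k / 2 / 2 ^+ r :> R.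
Proof.
case: (leqP k r) => kr.
  by apply: (@le_trans _ _ r%:R); rewrite ?ler_nat // lerDl !divr_ge0 ?exprn_ge0.
have -> : k = (r + (k - r).-1.+1)%N by rewrite prednK ?subn_gt0 // subnKC // ltnW.
move: (k - r).-1 => j; rewrite natrD lerD2l exprD exprS mulrCA.
rewrite [2 * _]mulrC mulfK ?pnatr_eq0 // mulrC mulKf ?pow2_neq0 //.
by rewrite -natrX ler_nat ltn_expl.
Qed.

(* The random set with law [y] is obtained by thinning the Fourier distribution
   of [f] so that it contains every [i] with probability exactly [dweight f i];
   a set [S] weighted by [2 ^ |T|], [T] a maximal monomial above [S], is active
   often enough for the packing bound to control the mean of [2 ^ |S|]. *)
Lemma sum_dweight_le f D r : (forall S, mono R f S -> (#|S| <= D)%N) ->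
  \sum_i dweight R f i <= r%:R + D%:R ^+ 2 / 2 ^+ r.
Proof.
move=> fD.
have [y [y0 y1 yu yT]] : exists z : {set 'I_n} -> R, [/\ forall S, 0 <= z S,
    \sum_S z S = \sum_S fourier (sgnf f) S ^+ 2,
    forall i, \sum_(S : {set 'I_n} | i \in S) z S = dweight R f i
    & forall S, z S != 0 -> exists2 T : {set 'I_n}, S \subset T & fourier (sgnf f) T ^+ 2 != 0].
  apply: thinning => [S|i|i]; rewrite ?sqr_ge0 ?dweight_ge0 // sgnf_influence.
  exact: weight_le_influence (@dweight_is_weight R n).
rewrite sum_sgnf2 in y1.
have ymono S : y S != 0 -> S != set0 -> mono R f S.
  move=> /yT [T ST]; rewrite sqrf_eq0 => FT S0; apply: (mono_sub ST).
  apply: fourier_mono FT; apply: contra_neq S0 => e; apply/eqP.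
  by rewrite -subset0 -e.
have /choice [t tP] S : exists t : nat, mono R f S -> (forall i, i \in S -> (t <= locdeg R f i)%N) /\
    2 ^+ #|S| <= 2 ^+ t * avg (fun x => (bder f S x != 0)%:R : R).
  case: (boolP (mono R f S)) => [mS|]; last by exists 0%N.
  have [T [ST mT act]] := mono_active mS; exists #|T| => _; split=> // i iS.
  by apply: locdeg_ge (maxsetp mT) (subsetP ST i iS).
(* For [i] in an active [S], the factor [2 ^ t S / 2] is at most [2 ^ locdeg R f i / 2], the inverse
   of [dweight R f i]. Since [y] has load [dweight R f i] at [i], the load of [Y x] is at most 1. *)
pose Y x S := if (S != set0) && (bder f S x != 0) then y S * (2 ^+ t S / 2) else 0.
have pack x : \sum_S Y x S <= D%:R ^+ 2.
  apply: (frac_packing (f := f) (x := x)).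
  - move=> T DT; apply/eqP/negPn/negP => d; move: DT; rewrite ltnNge => /negP; apply; apply: fD.
    by apply/monoP; exists x.
  - by move=> S; rewrite /Y; case: ifP => // _; rewrite mulr_ge0 // divr_ge0 ?exprn_ge0.
  - by move=> S; rewrite /Y; case: ifP => [/andP[]|]; rewrite ?eqxx.
  move=> i; apply: (@le_trans _ _ (\sum_(S : {set 'I_n} | i \in S) y S * (2 ^+ locdeg R f i / 2))).
    apply: ler_sum => S iS; rewrite /Y.
    have p0 m : 0 <= 2 ^+ m / 2 :> R by rewrite divr_ge0 ?exprn_ge0.
    case: ifP => [/andP[S0 d]|_]; last by rewrite mulr_ge0.
    apply: ler_wpM2l => //; rewrite ler_pM2r ?invr_gt0 ?ltr0n // ler_eXn2l ?ltr1n //.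
    have mS : mono R f S by apply/monoP; exists x.
    by have [-> //] := tP S mS.
  rewrite -mulr_suml yu /dweight; case: ifP => _; last by rewrite mul0r ler01.
  by rewrite mulrA divfK ?pow2_neq0 // divff ?pnatr_eq0.
have bound : \sum_(S : {set 'I_n} | S != set0) y S * (2 ^+ #|S| / 2) <= D%:R ^+ 2.
  apply: (@le_trans _ _ (avg (fun x => \sum_S Y x S))); last first.
    by rewrite -(avg_cst n (D%:R ^+ 2)); apply: ler_avg.
  rewrite avg_sum big_mkcond /=; apply: ler_sum => S _.
  case: ifP => S0; last by apply: avg_ge0 => x; rewrite /Y S0.
  rewrite (eq_avg (G := fun x => (y S * (2 ^+ t S / 2)) * (bder f S x != 0)%:R)); last first.
    by move=> x; rewrite /Y S0 /=; case: ifP => _; rewrite ?mulr1 ?mulr0.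
  rewrite avgZ -mulrA; have [->|/ymono/(_ S0) mS] := eqVneq (y S) 0; first by rewrite !mul0r.
  apply: ler_wpM2l => //; rewrite mulrAC ler_pM2r ?invr_gt0 ?ltr0n //.
  by have [_] := tP S mS.
under eq_bigr => i _ do rewrite -yu.
rewrite sum_loads.
apply: (@le_trans _ _ (\sum_S y S * r%:R +
  \sum_(S : {set 'I_n} | S != set0) y S * (2 ^+ #|S| / 2) / 2 ^+ r)).
  rewrite [X in _ + X]big_mkcond -big_split; apply: ler_sum => S _ /=.
  case: ifP => [_|/negbFE/eqP ->]; last by rewrite cards0 mulr0 addr0 mulr_ge0.
  by rewrite -!mulrA -mulrDr ler_wpM2l // mulrA leq_add_pow.
rewrite -mulr_suml y1 mul1r lerD2l -mulr_suml.
by rewrite ler_pM2r ?invr_gt0 ?pow2_gt0.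
Qed.

End Fourier.

(** * Greedy elimination of large monomials *)

Section DegreeBound.
Variables (R : realType) (n : nat).
Implicit Types (f : boolfun n) (x : cube n) (S T H : {set 'I_n}) (i : 'I_n) (L M : {set {set 'I_n}}).

Notation bder f := (der (fun y => (f y)%:R : R)).
Notation mono f S := (mono R f S).

Definition mono_le f H s := forall T, mono f T -> [disjoint T & H] -> (#|T| <= s)%N.

Definition family f H L :=
  trivIset L && [forall S in L, [&& mono f S, [disjoint S & H] & S != set0]].

Definition actp f S : R := avg (fun x => (bder f S x != 0)%:R).

Lemma actp_ge0 f S : 0 <= actp f S.
Proof. by apply: avg_ge0 => x; rewrite ler0n. Qed.

(** At each [x] the active members of the disjoint family form a packing for the restriction
    [restr f H x], whose monomials have size at most [s]; then average [frac_packing] over [x]. *)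
Lemma family_actp f H L s : mono_le f H s -> family f H L ->
  \sum_(S in L) actp f S <= s%:R ^+ 2.
Proof.
move=> fs /andP[/trivIsetP tL /forall_inP fL].
rewrite -avg_sum -(avg_cst n (s%:R ^+ 2)); apply: ler_avg => x.
pose Y S : R := if (S \in L) && (bder f S x != 0) then 1 else 0.
rewrite (eq_bigr Y) => [|S SL]; last by rewrite /Y SL; case: (_ != _).
rewrite big_mkcond (eq_bigr Y) => [|S _]; last by rewrite /Y; case: (S \in L).
apply: (frac_packing (f := restr f H x) (x := x)).
- move=> T sT; apply/eqP/negPn/negP => d; move: sT; rewrite ltnNge => /negP; apply.
  have : mono (restr f H x) T by apply/monoP; exists x.
  by case/mono_restr => mT dT; apply: fs.
- by move=> S; rewrite /Y; case: ifP; rewrite ?ler01.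
- move=> S; rewrite /Y; case: ifP => [/andP[SL d] _|]; last by rewrite eqxx.
  by have /and3P[_ dS ->] := fL S SL; rewrite bder_restr dS mixid.
move=> i; case: (pickP (fun S => (i \in S) && (S \in L))) => [S0 /andP[iS0 S0L]|no].
  rewrite (bigD1 S0) //= big1 => [|S /andP[iS SS0]].
    by rewrite addr0 /Y; case: ifP; rewrite ?ler01.
  rewrite /Y; case: ifP => // /andP[SL _].
  by have := disjointFr (tL _ _ SL S0L SS0) iS; rewrite iS0.
by rewrite big1 ?ler01 // => S iS; rewrite /Y; have := no S; rewrite /= iS /= => ->.
Qed.

Lemma dweight_actp f S i : mono f S -> i \in S ->
  dweight R f i <= 2 * (actp f S / 2 ^+ #|S|).
Proof.
move=> mS iS; have [T [ST /maxsetp mT act]] := mono_active mS.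
rewrite /dweight (mono_relevant mS iS) ler_pM2l ?ltr0n //.
rewrite ler_pdivlMr ?pow2_gt0 // ler_pdivrMl ?pow2_gt0 //.
apply: (le_trans act); rewrite ler_wpM2r ?actp_ge0 // ler_eXn2l ?ltr1n //.
exact: locdeg_ge mT (subsetP ST i iS).
Qed.

Definition lcost (s : nat) : R := s%:R / 2 ^+ s.
(** Closed form of the sum of [m ^ 2 (lcost m - lcost m.+1)] over all [m >= s]. *)
Definition lpot (s : nat) : R := (s%:R ^+ 3 + 2 * s%:R ^+ 2 + 7 * s%:R + 10) / 2 ^+ s.

Lemma lpotE s : lpot s - lpot s.+1 = s%:R ^+ 2 * (lcost s - lcost s.+1).
Proof.
have e : s.+1%:R = s%:R + 1 :> R by rewrite -natr1.
rewrite /lpot /lcost [2 ^+ s.+1]exprS e; move: (pow2_neq0 R s); move: (2 ^+ s) => u u0.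
by field; rewrite u0.
Qed.

Lemma lcost_dec s : (0 < s)%N -> lcost s.+1 <= lcost s.
Proof.
move=> s0; rewrite /lcost exprS ler_pdivrMr ?mulr_gt0 ?pow2_gt0 // mulrAC.
rewrite ler_pdivlMr ?pow2_gt0 // mulrA ler_pM2r ?pow2_gt0 // mulr_natr -mulrnA ler_nat; lia.
Qed.

Lemma sum_cover_weight f H L : family f H L ->
  \sum_(i in cover L) dweight R f i <= 2 * \sum_(S in L) actp f S * lcost #|S|.
Proof.
move=> /andP[tL /forall_inP fL]; rewrite big_trivIset //= mulr_sumr.
apply: ler_sum => S SL; have /and3P[mS _ _] := fL S SL.
apply: (@le_trans _ _ (\sum_(i in S) 2 * (actp f S / 2 ^+ #|S|))).
  by apply: ler_sum => i iS; apply: dweight_actp.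
rewrite sumr_const -[leLHS]mulr_natr /lcost le_eqVlt; apply/orP; left; apply/eqP; ring.
Qed.

(** A maximal disjoint family of monomials of the top size meets every monomial of that size. *)
Lemma mono_le_max f H s : mono_le f H s.+1 ->
  exists M, [/\ family f H M, forall S, S \in M -> #|S| = s.+1 & mono_le f (H :|: cover M) s].
Proof.
move=> fs.
pose P M := family f H M && [forall S in M, #|S| == s.+1].
have P0 : P set0.
  apply/andP; split; last by apply/forall_inP => S; rewrite inE.
  apply/andP; split; last by apply/forall_inP => S; rewrite inE.
  by apply/trivIsetP => A B; rewrite inE.
have [M /maxsetP [/andP[fM /forall_inP cM] maxM] _] := maxset_exists P0.
exists M; split=> // [S SM|T mT]; first exact/eqP/cM.
move=> dT; have dTH : [disjoint T & H] by apply: disjointWr dT; apply: subsetUl.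
rewrite -ltnS ltn_neqAle fs // andbT; apply/eqP => sT.
have TM : T \in M; last first.
  have /card_gt0P [i iT] : (0 < #|T|)%N by rewrite sT.
  have := disjointFr dT iT; rewrite inE; suff -> : i \in cover M by rewrite orbT.
  by apply/bigcupP; exists T.
have dTM A : A \in M -> [disjoint A & T].
  move=> AM; rewrite disjoint_sym; apply: disjointWr dT.
  by apply: subset_trans (subsetUr _ _); apply: bigcup_sup AM.
rewrite -(maxM (T |: M)) ?setU11 ?subsetUr //; apply/andP; split; last first.
  by apply/forall_inP => S; rewrite !inE => /orP[/eqP ->|/cM //]; rewrite sT.
move: fM => /andP[/trivIsetP tM /forall_inP fM]; apply/andP; split; last first.
  apply/forall_inP => S; rewrite !inE => /orP[/eqP ->|/fM //].
  by rewrite mT dTH -card_gt0 sT.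
apply/trivIsetP => A B; rewrite !inE => /orP[/eqP ->|AM] /orP[/eqP ->|BM] AB.
- by rewrite eqxx in AB.
- by rewrite disjoint_sym dTM.
- exact: dTM.
- exact: tM.
Qed.

(** Sizes are eliminated from the top down. All sets chosen together have total activity at most the
    square of the top size, so Abel summation of the costs leaves terms that telescope through
    [lpot]. *)
Lemma greedy_family f s H : mono_le f H (13 + s) -> exists L,
  [/\ family f H L, mono_le f (H :|: cover L) 13
    & \sum_(S in L) actp f S * lcost #|S| <=
      (\sum_(S in L) actp f S) * lcost (14 + s) + (lpot 14 - lpot (14 + s))].
Proof.
elim: s H => [|s IH] H fs.
  exists set0; rewrite /cover !big_set0 setU0 mul0r add0r subrr; split=> //.
  apply/andP; split; last by apply/forall_inP => S; rewrite inE.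
  by apply/trivIsetP => A B; rewrite inE.
have [M [fM cM lM]] : exists M, [/\ family f H M, forall S, S \in M -> #|S| = (14 + s)%N
    & mono_le f (H :|: cover M) (13 + s)] by rewrite addnS in fs; apply: mono_le_max.
have [L [fL lL costL]] := IH _ lM.
have dML : [disjoint M & L].
  apply/pred0P => S /=; apply/negP => /andP[SM SL].
  move: fL => /andP[_ /forall_inP /(_ S SL) /and3P[_ dS /set0Pn [i iS]]].
  have := disjointFr dS iS; rewrite inE; suff -> : i \in cover M by rewrite orbT.
  by apply/bigcupP; exists S.
have coverU : cover (M :|: L) = cover M :|: cover L by rewrite /cover bigcup_setU.
have fML : family f H (M :|: L).
  move: fM fL => /andP[/trivIsetP tM /forall_inP fM] /andP[/trivIsetP tL /forall_inP fL].
  have dd A B : A \in M -> B \in L -> [disjoint A & B].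
    move=> AM BL; have /and3P[_ d _] := fL B BL; rewrite disjoint_sym.
    apply: disjointWr d; apply: subset_trans (subsetUr _ _).
    by apply: bigcup_sup AM.
  apply/andP; split.
    apply/trivIsetP => A B; rewrite !inE => /orP[AM|AL] /orP[BM|BL] AB.
    - exact: tM.
    - exact: dd.
    - by rewrite disjoint_sym; apply: dd.
    - exact: tL.
  apply/forall_inP => S; rewrite inE => /orP[/fM //|/fL /and3P[-> d ->]].
  by rewrite andbT /=; apply: disjointWr d; apply: subsetUl.
exists (M :|: L); split=> //.
  by rewrite coverU setUA.
have sU (F : {set 'I_n} -> R) : \sum_(S in M :|: L) F S = \sum_(S in M) F S + \sum_(S in L) F S.
  by rewrite -bigU //; apply: eq_bigl => S; rewrite !inE.
rewrite !sU (eq_bigr (fun S => actp f S * lcost (14 + s))) => [|S SM]; last by rewrite cM.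
rewrite -mulr_suml.
have := family_actp fs fML; rewrite sU => PML.
(* Raising the threshold replaces [lcost (14 + s)] by [lcost (14 + s).+1]; the difference, times an
   activity of at most [(14 + s) ^ 2], is the increment in [lpotE]. *)
have := lpotE (14 + s); have := lcost_dec (isT : (0 < 14 + s)%N).
rewrite -[(14 + s.+1)%N]/((14 + s).+1) addnS in PML *.
move: PML costL; rewrite -[((13 + s).+1)%N]/(14 + s)%N.
set pM := \sum_(S in M) _; set pL := \sum_(S in L) actp f S; set q := \sum_(S in L) _.
move: (lcost _) (lcost _) (lpot _) (lpot _) => c c' a b; nra.
Qed.

(* Above the size 14 the cost telescopes to at most [2 * lpot 14]; the parameters
   of [sum_dweight_le] at the leaves are [D = 13] and [r = 7]. *)
Lemma sum_dweight_bound f : \sum_i dweight R f i <= 8788 / 1000.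
Proof.
have fn : mono_le f set0 (13 + n).
  by move=> T _ _; apply: leq_trans (max_card _) _; rewrite card_ord leq_addl.
have [L [fL lL cost]] := greedy_family fn; rewrite set0U in lL.
apply: le_trans (sum_weight_restr f (cover L) (@dweight_is_weight R n)) _.
have leaf : avg (fun x => \sum_i dweight R (restr f (cover L) x) i) <= 7 + 13 ^+ 2 / 2 ^+ 7.
  rewrite -(avg_cst n (7 + 13 ^+ 2 / 2 ^+ 7)); apply: ler_avg => x.
  by apply: (@sum_dweight_le R n _ 13 7) => S /mono_restr [mS dS]; apply: lL.
have P2 := family_actp fn fL.
have l0 : 0 <= lcost (14 + n) by rewrite divr_ge0 ?ler0n ?exprn_ge0.
(* The boundary term of the summation is absorbed by the [- lpot (14 + n)] of [greedy_family]. *)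
have l1 : (\sum_(S in L) actp f S) * lcost (14 + n) <= lpot (14 + n).
  apply: le_trans (ler_wpM2r l0 P2) _.
  rewrite /lcost /lpot mulrA ler_pM2r ?invr_gt0 ?pow2_gt0 // !natrD.
  have : 0 <= n%:R :> R by rewrite ler0n.
  by move: (n%:R) => m m0; nra.
apply: le_trans (lerD (sum_cover_weight fL) leaf) _.
have l14 : lpot 14 = 3244 / 16384 by rewrite /lpot; lra.
have : \sum_(S in L) actp f S * lcost #|S| <= 3244 / 16384.
  apply: (le_trans cost); rewrite -l14; lra.
lra.
Qed.

End DegreeBound.

(** * The degree bound, and the certificate bound through a forest *)

Section Forest.
Variables (R : realType) (n : nat).
Implicit Types (f : boolfun n) (x y : cube n) (S K : {set 'I_n}) (i j : 'I_n).

Lemma nrelevant_le f (a b : R) (w : 'I_n -> R) : (forall i, 0 <= w i) ->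
  (forall i, relevant f i -> a <= w i) -> \sum_i w i <= b -> (nrelevant f)%:R * a <= b.
Proof.
move=> w0 aw; apply: le_trans.
rewrite (bigID (relevant f)) /= -[leLHS]addr0 lerD ?sumr_ge0 //.
rewrite mulr_natl -sumr_const (eq_bigl (relevant f)) => [|i]; last by rewrite inE.
by apply: ler_sum => i; apply: aw.
Qed.

Lemma nrelevant_deg f : (nrelevant f)%:R <= 4394 / 1000 * 2 ^+ deg R f :> R.
Proof.
have : (nrelevant f)%:R * (2 / 2 ^+ deg R f) <= 8788 / 1000 :> R.
  apply: (nrelevant_le (w := dweight R f)) (sum_dweight_bound R f) => [i|i ri].
    exact: dweight_ge0.
  rewrite /dweight ri ler_pM2l ?ltr0n // lef_pV2 ?posrE ?pow2_gt0 // ler_eXn2l ?ltr1n //.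
  by apply: locdeg_le => S /mono_deg.
by rewrite mulrA ler_pdivrMr ?pow2_gt0 //; move: (2 ^+ _) (_%:R) => u m; lra.
Qed.

Definition in_subcube K x y := [forall k in K, y k == x k].

Lemma in_subcubeP K x y : reflect {in K, y =1 x} (in_subcube K x y).
Proof. by apply: (iffP forall_inP) => H k /H /eqP. Qed.

Lemma in_subcube_avg K x : 1 <= 2 ^+ #|K| * avg (fun y => (in_subcube K x y)%:R : R).
Proof.
rewrite -natrX -card_powerset mulr_natl -sumr_const.
rewrite (eq_bigr (fun V => avg (fun y => (in_subcube K x (flip y V))%:R))); last first.
  by move=> V _; rewrite (avg_flip V (fun y => (in_subcube K x y)%:R : R)).
rewrite -avg_sum; apply: (@le_trans _ _ (avg (fun=> 1))); first by rewrite avg_cst.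
apply: ler_avg => y; pose V := [set k in K | y k != x k].
have VK : V \in powerset K by rewrite powersetE; apply/subsetP => k; rewrite inE => /andP[].
rewrite (bigD1 V VK) /=.
have -> : in_subcube K x (flip y V).
  apply/in_subcubeP => k kK; rewrite ffunE inE kK /=.
  by case: (y k); case: (x k).
by rewrite lerDl; apply: sumr_ge0 => *; apply: ler0n.
Qed.

(** * Walks along the edges selected by a family of subcubes *)

Section Walks.
Variables (A : {set 'I_n}) (K : 'I_n -> {set 'I_n}) (a : 'I_n -> cube n).
Hypothesis iK : forall i, i \in A -> i \notin K i.
Hypothesis crossing : forall i j x, i \in A -> j \in A -> i != j ->
  in_subcube (K i) (a i) x -> in_subcube (K j) (a j) x -> j \in K i.

Definition edge x i := (i \in A) && in_subcube (K i) (a i) x.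

Lemma edge_flip x i : edge (flip x [set i]) i = edge x i.
Proof.
rewrite /edge; case: (boolP (i \in A)) => //= iA; apply: eq_forallb => k.
case: (boolP (k \in K i)) => //= kK.
have ki : k != i by apply: contraTneq kK => ->; exact: iK.
by rewrite ffunE inE (negPf ki).
Qed.

(** The condition on [ohead] forbids turning back along the edge just crossed. *)
Fixpoint walk x (w : seq 'I_n) : bool :=
  if w is i :: w' then [&& edge x i, ohead w' != Some i & walk (flip x [set i]) w'] else true.

Definition walk_end x (w : seq 'I_n) := foldl (fun y i => flip y [set i]) x w.

Lemma walk_cat x u i v : walk x (u ++ i :: v) -> edge (walk_end x u) i.
Proof. by elim: u x => [|j u IH] x /= /and3P[] // _ _ /IH. Qed.

Lemma walk_end_out x u j : j \notin u -> walk_end x u j = x j.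
Proof.
elim: u x => [|i u IH] x //=; rewrite inE negb_or => /andP[ji ju].
by rewrite IH // ffunE inE (negPf ji).
Qed.

(** Suppose the first letter [i] recurs and let [j] be the next letter. By [crossing], [K i]
    contains [j]; but [j] is flipped exactly once before [i] is used again, so the walk is then
    outside the subcube of [i]. *)
Lemma walk_uniq x w : walk x w -> uniq w.
Proof.
elim: w x => [|i w IH] x //= /and3P[xi hd ww]; rewrite (IH _ ww) andbT.
apply/negP => iw; have uw := IH _ ww; move: iw hd ww uw.
case/splitPr => -[|j u] v /= hd; first by rewrite eqxx in hd.
move=> /and3P[xj _ ww] /andP[ju _].
have jA : j \in A by case/andP: xj.
have /andP[iA xi'] : edge (flip x [set i]) i by rewrite edge_flip.
have ij : i != j.
  by apply: contraNneq ju => <-; rewrite mem_cat mem_head orbT.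
have jK : j \in K i by apply: (crossing iA jA ij xi'); case/andP: xj.
have /andP[_ /in_subcubeP /(_ j jK)] := walk_cat ww.
rewrite walk_end_out; last by apply: contra ju => ju; rewrite mem_cat ju.
move/in_subcubeP: xi' => /(_ j jK) <-; rewrite ffunE set11.
by case: (flip x [set i] j).
Qed.

Definition reach x i k := [exists t : k.-tuple 'I_n, walk x (i :: t)].

(** The range of [k] loses no walk, since by [walk_uniq] the letters of a walk are distinct. *)
Definition depth x i : nat := \max_(k < n.+1 | reach x i k) k.

Lemma reach_depth x i : edge x i -> reach x i (depth x i).
Proof.
move=> xi; have r0 : reach x i (ord0 : 'I_n.+1).
  by apply/existsP; exists [tuple]; rewrite /= xi.
rewrite /depth.
pose B := [pred k : 'I_n.+1 | reach x i k].
have B0 : (0 < #|B|)%N by apply/card_gt0P; exists ord0.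
by have [k rk ->] := bigop.eq_bigmax_cond (fun k : 'I_n.+1 => k : nat) B0; apply: rk.
Qed.

(** A longest walk leaving [x] through [j] is prolonged by entering [x] through [i]. *)
Lemma depth_lt x i j : edge x i -> edge x j -> i != j ->
  (depth x j < depth (flip x [set i]) i)%N.
Proof.
move=> xi xj ij; have /existsP [t wt] := reach_depth xj.
have wt' : walk (flip x [set i]) [:: i, j & t].
  by rewrite /= edge_flip xi (inj_eq (@Some_inj _)) eq_sym ij flipK /=.
have sz : (size [:: i, j & t] <= size (enum 'I_n))%N.
  by apply: uniq_leq_size (walk_uniq wt') _ => k _; rewrite mem_enum.
have sz' : ((depth x j).+1 < n.+1)%N by move: sz; rewrite size_enum_ord /= size_tuple; lia.
apply: (leq_bigmax_cond (Ordinal sz')).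
by apply/existsP; exists [tuple of j :: t].
Qed.

(* The edges form a forest, because no letter is repeated along a walk without
   backtracking; directing every edge towards its longer branch leaves at most
   one outgoing edge at each vertex. *)
Lemma forest_bound : \sum_(i in A) avg (fun x => (in_subcube (K i) (a i) x)%:R : R) <= 2.
Proof.
pose out x i := edge x i && (depth (flip x [set i]) i <= depth x i)%N.
have out1 x : \sum_i (out x i)%:R <= 1 :> R.
  case: (pickP (out x)) => [i oi|no]; last by rewrite big1 ?ler01 // => i _; rewrite no.
  rewrite (bigD1 i) //= oi big1 ?addr0 // => j ji.
  (* Two outgoing edges at [x] would give [depth x j < depth (flip x [set i]) i <= depth x i], and
     the same with [i] and [j] exchanged. *)
  suff -> : out x j = false by []; apply/negP => oj; move: oi oj => /andP[xi di] /andP[xj dj].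
  have ij : i != j by rewrite eq_sym.
  have := depth_lt xi xj ij; have := depth_lt xj xi ji; lia.
apply: (@le_trans _ _ (\sum_i (avg (fun x => (out x i)%:R : R) +
    avg (fun x => (out (flip x [set i]) i)%:R : R)))).
  rewrite big_mkcond; apply: ler_sum => i _; case: ifP => iA; last first.
    by rewrite addr_ge0 // avg_ge0 // => x; rewrite ler0n.
  rewrite -avgD; apply: ler_avg => x.
  have -> : in_subcube (K i) (a i) x = edge x i by rewrite /edge iA.
  rewrite /out edge_flip flipK; case: (edge x i) => //=.
    case: (leqP (depth (flip x [set i]) i) (depth x i)) => l.
      by rewrite lerDl ler0n.
    by rewrite (ltnW l) lerDr ler0n.
  by rewrite addr_ge0.
rewrite (eq_bigr (fun i => 2 * avg (fun x => (out x i)%:R : R))); last first.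
  by move=> i _; rewrite (avg_flip [set i] (fun x => (out x i)%:R : R)) mulrDl mul1r.
rewrite -mulr_sumr -avg_sum -[leRHS]mulr1 ler_pM2l ?ltr0n //.
by apply: (@le_trans _ _ (avg (fun _ : cube n => 1))); [apply: ler_avg|rewrite avg_cst].
Qed.

End Walks.

Lemma certP f x : exists2 S : {set 'I_n},
  (#|S| <= cert f)%N & forall y, {in S, y =1 x} -> f y = f x.
Proof.
have c0 := is_certT f x; exists [arg min_(S < [set: 'I_n] | is_cert f x S) #|S|]%N.
  exact: (leq_bigmax x).
case: arg_minnP => // S /forall_inP cS _ y yx; apply/eqP.
have yS : y \in [set y : cube n | [forall i in S, y i == x i]].
  by rewrite inE; apply/forall_inP => i iS; rewrite yx.
have xS : x \in [set y : cube n | [forall i in S, y i == x i]].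
  by rewrite inE; apply/forall_inP => i iS.
by have /forall_inP := cS y yS; apply.
Qed.

Lemma nrelevant_cert f : (nrelevant f)%:R <= 1 / 2 * 4 ^+ cert f :> R.
Proof.
pose x0 : cube n := [ffun=> false].
have /choice [q qP] i : exists q : cube n * {set 'I_n}, relevant f i ->
    [/\ i \notin q.2, (#|q.2| + 2 <= 2 * cert f)%N, forall y, in_subcube q.2 q.1 y -> sbit f y i
      & forall y z, in_subcube q.2 q.1 y -> in_subcube q.2 q.1 z -> y i = z i -> f y = f z].
  case: (boolP (relevant f i)) => [/relevantP [x sx]|]; last by exists (x0, set0).
  have [S cS fS] := certP f x; have [T cT fT] := certP f (flip x [set i]).
  have agree (U : {set 'I_n}) z : i \notin U -> {in U, flip z [set i] =1 z}.
    by move=> iU k kU; rewrite ffunE inE; case: eqP => // e; rewrite e (negPf iU) in kU.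
  have iS : i \in S.
    by apply: contraT => iS; move: sx; rewrite /sbit (fS (flip x [set i])) ?eqxx //; apply: agree.
  have iT : i \in T.
    apply: contraT => iT; move: sx; rewrite /sbit (fT x) ?eqxx // => k kT.
    by rewrite (agree T x iT k kT).
  (* Both certificates contain [i], so removing it leaves at most [2 * cert f - 2] variables. *)
  pose U := (S :\ i) :|: (T :\ i).
  have val y : in_subcube U x y -> f y = if y i == x i then f x else f (flip x [set i]).
    move=> /in_subcubeP yU; case: eqP => yi; [apply: fS|apply: fT] => k kS.
      by have [->//|ki] := eqVneq k i; apply: yU; rewrite !inE ki kS.
    rewrite ffunE inE; have [->|ki] := eqVneq k i; last by apply: yU; rewrite !inE ki kS orbT.
    by move: yi; case: (y i); case: (x i).
  exists (x, U) => _ /=; split.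
  - by rewrite !inE eqxx.
  - have eS : #|S| = #|S :\ i|.+1 by rewrite (cardsD1 i S) iS.
    have eT : #|T| = #|T :\ i|.+1 by rewrite (cardsD1 i T) iT.
    move: (cardsU (S :\ i) (T :\ i)) cS cT; rewrite -/U eS eT.
    by move: #|U| #|S :\ i| #|T :\ i| #|_| (cert f) => u s t v c; lia.
  - move=> y yU; have yU' : in_subcube U x (flip y [set i]).
      move/in_subcubeP: yU => yU; apply/in_subcubeP => k kU; rewrite ffunE inE.
      case: eqP => [e|_]; last exact: yU.
      by move: kU; rewrite e !inE eqxx.
    rewrite /sbit (val _ yU) (val _ yU') ffunE set11; move: sx; rewrite /sbit.
    by case: (y i); case: (x i) => //=; rewrite eq_sym.
  by move=> y z yU zU yz; rewrite (val _ yU) (val _ zU) yz.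
pose A := [set i | relevant f i].
have bound : \sum_(i in A) avg (fun x => (in_subcube (q i).2 (q i).1 x)%:R : R) <= 2.
  apply: forest_bound => [i|i j x]; rewrite !inE.
    by case/qP.
  (* Otherwise flipping [j] would stay in the subcube of [i], where [f] depends on bit [i] alone,
     although [f] is sensitive to [j] at [x]. *)
  move=> ri rj ij xi xj; apply: contraT => jK.
  have [_ _ _ ci] := qP i ri; have [_ _ sj _] := qP j rj.
  have := sj x xj; rewrite /sbit (ci x (flip x [set j])) ?eqxx //.
    move/in_subcubeP: xi => xi; apply/in_subcubeP => k kU; rewrite ffunE inE.
    case: eqP => [e|_]; last exact: xi.
    by rewrite e (negPf jK) in kU.
  by rewrite ffunE inE (negPf ij).
have four : 4 = 2 ^+ 2 :> R by rewrite expr2; lra.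
(* Codimension at most [2 * cert f - 2] means measure at least [4 / 4 ^ cert f]. *)
have : (nrelevant f)%:R * (4 / 4 ^+ cert f) <= 2 :> R.
  apply: le_trans bound; rewrite mulr_natl -sumr_const; apply: ler_sum => i.
  rewrite inE => ri; have [_ c _ _] := qP i ri.
  rewrite ler_pdivrMr ?exprn_gt0 // -(ler_pM2l (pow2_gt0 R #|(q i).2|)).
  apply: (@le_trans _ _ (2 ^+ (2 * cert f))).
    by rewrite four -exprD ler_eXn2l ?ltr1n.
  rewrite mulrA exprM -four ler_peMl ?exprn_ge0 //.
  exact: in_subcube_avg.
by rewrite mulrA ler_pdivrMr ?exprn_gt0 //; move: (4 ^+ _) (_%:R) => u m; lra.
Qed.

End Forest.

(** * Certificates and sensitivity of monotone functions *)

Section MonotoneCertificates.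
Variable n : nat.
Implicit Types (f : boolfun n) (x y : cube n) (S : {set 'I_n}) (i : 'I_n).

Lemma is_certP f x S : reflect (forall y, {in S, y =1 x} -> f y = f x) (is_cert f x S).
Proof.
have memP y : reflect {in S, y =1 x} (y \in [set y : cube n | [forall i in S, y i == x i]]).
  by rewrite inE; apply: (iffP forall_inP) => H i /H /eqP.
apply: (iffP forall_inP) => [H y /memP /H /forall_inP yH|H y /memP /H e].
  by apply/eqP; apply: yH; apply/memP.
by apply/forall_inP => z /memP /H ez; rewrite e ez.
Qed.

(** Extend [x] outside a minimal certificate by the value least favourable to [f x]. Every variable
    of the certificate is sensitive at that point [z], since otherwise monotonicity would allow
    dropping it. *)
Lemma cert_le_sens f : boolfun_monotone f -> (cert f <= sens f)%N.
Proof.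
move=> fmon; apply/bigmax_leqP => x _; rewrite /cert_at.
case: arg_minnP => [|S /is_certP cS minS]; first exact: is_certT.
pose z : cube n := [ffun j => if j \in S then x j else ~~ f x].
have fz : f z = f x by apply: cS => j jS; rewrite ffunE jS.
apply: leq_trans (leq_bigmax z); apply/subset_leq_card/subsetP => i iS; rewrite inE.
apply/negP => /eqP; rewrite fz => fzi.
suff c : is_cert f x (S :\ i) by have := minS _ c; rewrite (cardsD1 i S) iS ltnn.
apply/is_certP => y yS; have [e|ne] := eqVneq (y i) (x i).
  by apply: cS => j jS; have [->//|ji] := eqVneq j i; apply: yS; rewrite !inE ji.
have cmp j : if f x then (flip z [set i] j <= y j)%N else (y j <= flip z [set i] j)%N.
  rewrite !ffunE inE; have [->|ji] := eqVneq j i.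
    by rewrite iS; move: ne; case: (f x); case: (y i); case: (x i).
  case: (boolP (j \in S)) => jS; first by rewrite yS ?inE ?ji //; case: (f x).
  by case: (f x); case: (y j).
by case: (boolP (f x)) cmp fzi => [fx|/negPf fx] cmp fzi; rewrite ?fx in fzi *;
   have := fmon _ _ cmp; rewrite -fzi; case: (f y).
Qed.

End MonotoneCertificates.

(** * The sensitivity weight, and the mixed bound in degree and sensitivity *)

Section SensitivityWeight.
Variables (R : realType) (n : nat).
Implicit Types (f : boolfun n) (x y a : cube n) (S H : {set 'I_n}) (i h : 'I_n).

Lemma sens_at_restr f H a x : sens_at f (mix H a x) =
  (sens_at (restr f H a) x + #|[set j in H | sbit f (mix H a x) j]|)%N.
Proof.
rewrite /sens_at -(cardsID (~: H)); congr (_ + _)%N; apply: eq_card => j; rewrite !inE.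
  by rewrite andbC -[RHS]/(sbit _ _ _) sbit_restr.
by rewrite negbK andbC.
Qed.

(** The subtraction of 2 discounts direction [i] itself, counted at both ends. *)
Definition sigma f i : nat :=
  \max_(x : cube n | sbit f x i) (sens_at f x + sens_at f (flip x [set i]) - 2).

Lemma sigma_ge f x i : sbit f x i ->
  (sens_at f x + sens_at f (flip x [set i]) <= sigma f i + 2)%N.
Proof.
move=> s; rewrite [leqRHS]addnC -leq_subLR.
exact: (@bigop.leq_bigmax_cond _ (fun x => sbit f x i)
  (fun x => sens_at f x + sens_at f (flip x [set i]) - 2)%N x).
Qed.

Lemma sens_at_gt0 f x i : sbit f x i -> (0 < sens_at f x)%N.
Proof. by move=> s; apply/card_gt0P; exists i; rewrite inE. Qed.

Lemma sens_at_sigma f x i : sbit f x i -> (sens_at f x <= (sigma f i).+1)%N.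
Proof.
move=> s; have := sigma_ge s; have := @sens_at_gt0 f (flip x [set i]) i.
by rewrite sbit_flip => /(_ s); lia.
Qed.

Lemma sigma_sens f i : (sigma f i <= 2 * sens f - 2)%N.
Proof.
apply/bigmax_leqP => x _; rewrite leq_sub2r // mul2n -addnn.
exact: leq_add (sens_at_le _ _) (sens_at_le _ _).
Qed.

Lemma sigma_restr f H a i : (sigma (restr f H a) i <= sigma f i)%N.
Proof.
apply/bigmax_leqP => x; rewrite sbit_restr => /andP[iH s].
have d : [disjoint [set i] & H] by rewrite disjoints1.
have := sigma_ge s; rewrite -mix_flip // !sens_at_restr; lia.
Qed.

(** Across [h] the parallel edge is not sensitive, so [f] must change along [h] at one end of each
    sensitive edge in direction [i]. Fixing [h] removes that contribution. *)
Lemma sigma_restr_lt f i h a : i != h -> relevant (restr f [set h] a) i ->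
  ~~ relevant (restr f [set h] (flip a [set h])) i ->
  (sigma (restr f [set h] a) i < sigma f i)%N.
Proof.
move=> ih /relevantP [y sy] nr.
have : (0 < #|[pred x | sbit (restr f [set h] a) x i]|)%N by apply/card_gt0P; exists y.
move=> /(bigop.eq_bigmax_cond (fun x =>
  sens_at (restr f [set h] a) x + sens_at (restr f [set h] a) (flip x [set i]) - 2)%N).
rewrite -/(sigma _ _) => -[x]; rewrite inE => sx ->.
have d : [disjoint [set i] & [set h]] by rewrite disjoints1 inE.
have gt0 := sens_at_gt0 sx; have gt0' := @sens_at_gt0 (restr f [set h] a) (flip x [set i]) i.
rewrite sbit_flip in gt0'; have {}gt0' := gt0' sx.
move: sx; rewrite sbit_restr => /andP[_ sx].
have := sigma_ge sx; rewrite -mix_flip // !sens_at_restr mix_flip //.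
set z := mix _ _ _ in sx *.
suff : (0 < #|[set j in [set h] | sbit f z j]| +
            #|[set j in [set h] | sbit f (flip z [set i]) j]|)%N.
  move: gt0 gt0'; move: (sens_at _ x) (sens_at _ (flip x [set i])) => p q.
  by move: #|_| #|_| (sigma f i) => A B c; lia.
have nz : ~~ sbit f (flip z [set h]) i.
  apply: contra nr => s; apply/relevantP; exists x; rewrite sbit_restr inE ih /=.
  rewrite (_ : mix _ _ _ = flip z [set h]) //.
  by apply/ffunP => j; rewrite !ffunE inE; case: (j == h).
have [sh|] := boolP (sbit f z h).
  by rewrite ltn_addr //; apply/card_gt0P; exists h; rewrite !inE eqxx.
rewrite /sbit negbK => /eqP sh.
rewrite ltn_addl //; apply/card_gt0P; exists h; rewrite !inE eqxx /=.
move: nz sx; rewrite /sbit negbK -sh [flip (flip z [set i]) _]flipC => /eqP <-.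
by rewrite eq_sym.
Qed.

Definition sweight f i : R := if relevant f i then (2 ^+ sigma f i)^-1 else 0.

Lemma sweight_is_weight : is_weight sweight.
Proof.
split=> [f i|f i /negPf r|f i h x ih r1 r2|f i h x ih r1 r2].
- rewrite /sweight; case: ifP => _; rewrite ?lexx ?ler01 //.
  by rewrite invr_ge0 exprn_ge0 // invf_le1 ?pow2_gt0 // exprn_ege1 // ler1n.
- by rewrite /sweight r.
- have [r _] := relevant_restr r1; rewrite /sweight r r1.
  by rewrite lef_pV2 ?posrE ?pow2_gt0 // ler_eXn2l ?ltr1n // sigma_restr.
have [r _] := relevant_restr r1; rewrite /sweight r r1.
rewrite ler_pdivrMr ?pow2_gt0 // ler_pdivlMl ?pow2_gt0 // mulrC -exprS.
by rewrite ler_eXn2l ?ltr1n // sigma_restr_lt.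
Qed.

(** All the defining inequalities of a weight survive a geometric mean. *)
Lemma sqrt_weight u v : is_weight u -> is_weight v ->
  is_weight (fun f i => Num.sqrt (u f i * v f i) : R).
Proof.
move=> [u01 u0 urr ur] [v01 v0 vrr vr].
have u_ge0 f i : 0 <= u f i by case/andP: (u01 f i).
have v_ge0 f i : 0 <= v f i by case/andP: (v01 f i).
split=> [f i|f i r|f i h x ih r1 r2|f i h x ih r1 r2].
- rewrite sqrtr_ge0 /= -[leRHS]sqrtr1 ler_sqrt ?ler01 //.
  by case/andP: (u01 f i) (v01 f i) => _ ? /andP[_ ?]; rewrite mulr_ile1.
- by rewrite u0 ?mul0r ?sqrtr0.
- by rewrite ler_sqrt ?mulr_ge0 // ler_pM // ?urr ?vrr.
rewrite -[2]ger0_norm ?ler0n // -sqrtr_sqr -sqrtrM ?exprn_ge0 // expr2 mulrACA.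
by rewrite ler_sqrt ?mulr_ge0 // ler_pM ?mulr_ge0 ?ur ?vr ?ler0n.
Qed.

Definition gweight f i : R := Num.sqrt (dweight R f i * sweight f i).

Lemma gweight_is_weight : is_weight gweight.
Proof. exact: sqrt_weight (@dweight_is_weight R n) sweight_is_weight. Qed.

(** The cost of one restriction round at degree [d = 51 + k]: at most [d ^ 3] variables, each of
    weight at most [sqrt (2 / 2 ^ d)]. Raising [d] by 1 multiplies this by at most
    [(33/32) ^ 3 * 0.71], below [4/5]. *)
Lemma pow_decay k : (51 + k)%:R ^+ 3 * Num.sqrt (2 / 2 ^+ (51 + k)) <= 1 / 10 * (4 / 5) ^+ k :> R.
Proof.
have e0 m : 0 <= 2 / 2 ^+ m :> R by rewrite divr_ge0 ?exprn_ge0.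
elim: k => [|k IH].
  have -> : 2 / 2 ^+ (51 + 0) = (2 ^- 25) ^+ 2 :> R.
    rewrite exprVn -exprM addn0 (_ : 51 = (25 * 2).+1)%N // exprS invfM mulrA mulfV ?mul1r //.
  rewrite sqrtr_sqr ger0_norm ?invr_ge0 ?exprn_ge0 // expr0 mulr1 ler_pdivrMr ?pow2_gt0 //.
  have p6 : (51 + 0)%:R <= 2 ^+ 6 :> R by rewrite -natrX ler_nat.
  have p7 : 10 <= 2 ^+ 7 :> R by rewrite -natrX ler_nat.
  apply: (@le_trans _ _ (2 ^+ 18)).
    by rewrite (_ : 18 = 6 * 3)%N // exprM lerXn2r ?nnegrE ?ler0n ?exprn_ge0.
  rewrite (_ : 25 = 7 + 18)%N // exprD mulrA ler_peMl ?exprn_ge0 // mulrC mulrA mulr1.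
  by rewrite ler_pdivlMr ?mul1r.
have -> : 2 / 2 ^+ (51 + k.+1) = 1 / 2 * (2 / 2 ^+ (51 + k)) :> R.
  by rewrite addnS exprS; field; rewrite pow2_neq0.
rewrite sqrtrM ?divr_ge0 //; set r := Num.sqrt (1 / 2).
have r0 : 0 <= r by apply: sqrtr_ge0.
have r1 : r <= 71 / 100.
  by rewrite -[leRHS]ger0_norm // -sqrtr_sqr ler_sqrt ?sqr_ge0 //; lra.
rewrite [(4 / 5) ^+ k.+1]exprS; move: IH (sqrtr_ge0 (2 / 2 ^+ (51 + k) : R)).
set q := Num.sqrt _; set t := (4 / 5) ^+ k => IH q0.
rewrite addnS [_.+1%:R]mulrSr; have : 51 <= (51 + k)%:R :> R by rewrite ler_nat leq_addr.
move: IH; set d := (_ + k)%:R => IH d51.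
have d0 : 0 <= d by apply: le_trans d51.
have d1 : d + 1 <= 33 / 32 * d by lra.
have d3 : (d + 1) ^+ 3 <= (33 / 32) ^+ 3 * d ^+ 3.
  by rewrite -exprMn lerXn2r ?nnegrE //; lra.
apply: (@le_trans _ _ ((33 / 32) ^+ 3 * d ^+ 3 * (r * q))); first by rewrite ler_wpM2r // mulr_ge0.
rewrite (_ : _ * _ = (33 / 32) ^+ 3 * r * (d ^+ 3 * q)); last by ring.
apply: (@le_trans _ _ (4 / 5 * (d ^+ 3 * q))).
  rewrite ler_wpM2r ?mulr_ge0 ?exprn_ge0 //.
  have c3 : (33 / 32) ^+ 3 <= 11 / 10 :> R by rewrite !exprS expr0; lra.
  by apply: le_trans (ler_pM _ r0 c3 r1) _; [rewrite exprn_ge0 ?divr_ge0|lra].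
by move: (d ^+ 3 * q) IH => X; lra.
Qed.

(* AM-GM for degree at most 50, and beyond it the variables of a maximal disjoint
   family of monomials of top size are restricted. *)
Lemma sum_gweight f k : (forall S, mono R f S -> (#|S| <= 50 + k)%N) ->
  \sum_i gweight f i <= 22 - 1 / 2 * (4 / 5) ^+ k.
Proof.
elim: k f => [|k IH] f fD.
  (* [sqrt (u * v) <= u + v / 4], and with total influence at most 50 the sum is at most
     [8.788 + 12.5], below [22 - 1/2]. *)
  apply: (@le_trans _ _ (\sum_i (dweight R f i + 1 / 4 * influence R f i))).
    apply: ler_sum => i _; have u0 := dweight_ge0 R f i.
    have vi := weight_le_influence f i sweight_is_weight.
    have v0 : 0 <= sweight f i by case: sweight_is_weight => /(_ f i)/andP[].
    apply: (@le_trans _ _ (dweight R f i + 1 / 4 * sweight f i)); last by lra.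
    rewrite -[leRHS]ger0_norm; last by lra.
    rewrite -sqrtr_sqr ler_sqrt ?sqr_ge0 // -subr_ge0.
    rewrite (_ : _ - _ = (dweight R f i - 1 / 4 * sweight f i) ^+ 2) ?sqr_ge0 //; by field.
  rewrite big_split -mulr_sumr /= expr0.
  have := sum_dweight_bound R f.
  have := sum_influence_le_deg fD; rewrite addn0.
  by lra.
have fs : mono_le R f set0 (50 + k).+1 by move=> T /fD; rewrite addnS.
have [M [fM sM lM]] := mono_le_max fs; rewrite set0U in lM.
(* Monomials of the top size are maximal, hence active everywhere, so [family_actp] bounds their
   number by the square of their size. *)
have cover_le : (#|cover M|)%:R <= (51 + k)%:R ^+ 3 :> R.
  have cM : (#|cover M| <= #|M| * (51 + k))%N.
    apply: leq_trans (leq_card_cover M) _; rewrite -sum_nat_const; apply: leq_sum => S /sM ->.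
    by rewrite addSn.
  apply: (@le_trans _ _ (#|M| * (51 + k))%:R); first by rewrite ler_nat.
  rewrite natrM exprSr ler_wpM2r ?ler0n //; apply: le_trans (family_actp fs fM).
  rewrite -sumr_const; apply: ler_sum => S SM; rewrite /actp.
  apply: (@le_trans _ _ (avg (fun _ : cube n => 1))); first by rewrite avg_cst.
  apply: ler_avg => x; suff -> : der (fun y => (f y)%:R : R) S x != 0 by [].
  apply: bder_max; apply/maxsetP; case/andP: fM => _ /forall_inP /(_ S SM) /and3P[mS _ _].
  split=> // T mT ST; apply/esym/eqP; rewrite eqEcard ST (sM S SM).
  by apply: fs => //; rewrite -setI_eq0 setI0.
apply: le_trans (sum_weight_restr f (cover M) gweight_is_weight) _.
(* The slack between consecutive bounds is exactly the cost allowed by [pow_decay]. *)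
rewrite (_ : 22 - _ = 1 / 10 * (4 / 5) ^+ k + (22 - 1 / 2 * (4 / 5) ^+ k)); last first.
  by rewrite exprS; move: (_ ^+ k) => t; lra.
apply: lerD; last first.
  rewrite -[leRHS](avg_cst n); apply: ler_avg => x; apply: IH => S /mono_restr [mS dS].
  exact: lM.
apply: le_trans (pow_decay k); apply: le_trans (ler_wpM2r (sqrtr_ge0 _) cover_le).
apply: (@le_trans _ _ (\sum_(i in cover M) Num.sqrt (2 / 2 ^+ (51 + k)))); last first.
  by rewrite sumr_const [leRHS]mulr_natl.
apply: ler_sum => i /bigcupP [S SM iS].
have mS : mono R f S by case/andP: fM => _ /forall_inP /(_ S SM) /and3P[].
rewrite ler_sqrt ?divr_ge0 ?exprn_ge0 // -[leRHS]mulr1 ler_pM ?dweight_ge0 //.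
- by case: sweight_is_weight => /(_ f i)/andP[].
- rewrite /dweight (mono_relevant mS iS) ler_pM2l ?ltr0n // lef_pV2 ?posrE ?pow2_gt0 //.
  by rewrite ler_eXn2l ?ltr1n // addSn -(sM S SM) locdeg_ge.
by case: sweight_is_weight => /(_ f i)/andP[].
Qed.

Lemma sens_gt0 f i : relevant f i -> (0 < sens f)%N.
Proof. by move=> /relevantP [x /sens_at_gt0 s]; apply: leq_trans s (sens_at_le f x). Qed.

Lemma sweight_ge f i : relevant f i -> 4 / 4 ^+ sens f <= sweight f i.
Proof.
move=> r; rewrite /sweight r ler_pdivrMr ?exprn_gt0 // ler_pdivlMl ?pow2_gt0 //.
have -> : 4 = 2 ^+ 2 :> R by rewrite expr2; lra.
rewrite -exprM -exprD ler_eXn2l ?ltr1n //.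
by have := sigma_sens f i; have := sens_gt0 r; lia.
Qed.

Lemma nrelevant_deg_sens f :
  (nrelevant f)%:R <= 8277 / 1000 * 2 `^ ((deg R f)%:R / 2 + (sens f)%:R) :> R.
Proof.
have -> : 2 `^ ((deg R f)%:R / 2 + (sens f)%:R) = Num.sqrt (2 ^+ deg R f * 4 ^+ sens f) :> R.
  rewrite -[LHS]ger0_norm ?powR_ge0 // -sqrtr_sqr -powR_mulrn ?powR_ge0 // -powRrM.
  rewrite mulrDl divfK ?pnatr_eq0 // powRD ?pnatr_eq0 ?implybT // powR_mulrn // -natrM.
  by rewrite powR_mulrn // mulnC exprM (_ : 2 ^+ 2 = 4 :> R) // expr2; lra.
set u := 2 ^+ _; set v := 4 ^+ _.
have u0 : 0 < u by apply: exprn_gt0.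
have v0 : 0 < v by apply: exprn_gt0.
have bnd : \sum_i gweight f i <= 22.
  have fD : forall S, mono R f S -> (#|S| <= 50 + deg R f)%N.
    by move=> S /mono_deg mS; apply: leq_trans mS (leq_addl _ _).
  apply: le_trans (sum_gweight fD) _; rewrite gerBl mulr_ge0 ?divr_ge0 // exprn_ge0.
have H : (nrelevant f)%:R * Num.sqrt (2 / u * (4 / v)) <= 22 :> R.
  apply: (nrelevant_le (w := gweight f)) bnd => [i|i ri]; first exact: sqrtr_ge0.
  rewrite ler_sqrt ?mulr_ge0 ?dweight_ge0 //; last by case: sweight_is_weight => /(_ f i)/andP[].
  rewrite ler_pM ?divr_ge0 ?(ltW u0) ?(ltW v0) ?sweight_ge //.
  rewrite /dweight ri ler_pM2l ?ltr0n // lef_pV2 ?posrE ?pow2_gt0 // ler_eXn2l ?ltr1n //.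
  by apply: locdeg_le => S /mono_deg.
have uv0 : 0 < u * v by apply: mulr_gt0.
have e : 2 / u * (4 / v) = 8 / (u * v) by field; rewrite !gt_eqF.
have r0 : 0 < Num.sqrt (u * v) by rewrite sqrtr_gt0.
(* A relevant variable has weight at least [sqrt 8 / sqrt (u * v)], and [22 / 2.8] is below
   [8.277]. *)
have r8 : 28 / 10 <= Num.sqrt 8 :> R.
  by rewrite -[leLHS]ger0_norm ?divr_ge0 // -sqrtr_sqr ler_sqrt //; lra.
move: H; rewrite e [Num.sqrt (8 / _)]sqrtrM // sqrtrV ?(ltW uv0) // mulrA ler_pdivrMr //.
move: (Num.sqrt 8) (Num.sqrt (u * v)) (nrelevant f)%:R (ler0n R (nrelevant f)) r8 r0.
move=> r w m m0 r8 w0 H.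
have : m * (28 / 10) <= m * r by rewrite ler_wpM2l.
by lra.
Qed.

End SensitivityWeight.

(** * The bound mixing certificates and sensitivity *)

Section CertificateSensitivity.
Variables (R : realType) (n : nat).
Implicit Types (f : boolfun n) (x y z a : cube n) (S H : {set 'I_n}) (i h : 'I_n).

Lemma avg_mix H (F : cube n -> R) : avg (fun y => avg (fun x => F (mix H y x))) = avg F.
Proof.
rewrite -[RHS](avg_cst n) /avg; congr (_ / _); rewrite -!mulr_suml; congr (_ / _).
rewrite !pair_bigA /=; pose swap (p : cube n * cube n) := (mix H p.2 p.1, mix H p.1 p.2).
have swapK : involutive swap.
  by move=> [x y]; congr (_, _); apply/ffunP => i; rewrite !ffunE; case: (i \in H).
by rewrite [RHS](reindex_inj (inv_inj swapK)); apply: eq_bigr => -[x y].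
Qed.

(** One-sided, since the induction lowers the certificates of a single value. *)
Definition certified f b c := forall x, f x = b ->
  exists2 S : {set 'I_n}, (#|S| <= c)%N & forall y, {in S, y =1 x} -> f y = f x.

Lemma mix_eq H S a x y : {in S :\: H, y =1 x} -> {in S, mix H a y =1 mix H a x}.
Proof.
by move=> e i iS; rewrite !ffunE; case: (boolP (i \in H)) => // iH; rewrite e // inE iH.
Qed.

Lemma certified_restr f b c H a : certified f b c -> certified (restr f H a) b c.
Proof.
move=> fc x fx; have [S cS fS] := fc _ fx; exists (S :\: H).
  exact: leq_trans (subset_leq_card (subsetDl _ _)) cS.
by move=> y /(@mix_eq _ _ a) /fS.
Qed.

(* Certificates of opposite values intersect. *)
Lemma certified_restr_opp f b c H a x :
  (forall y, {in H, y =1 x} -> f y = ~~ b) -> certified f b c.+1 ->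
  certified (restr f H a) b c.
Proof.
move=> fH fc z fz; have [S cS fS] := fc _ fz; exists (S :\: H); last first.
  by move=> y /(@mix_eq _ _ a) /fS.
suff : (0 < #|S :&: H|)%N by have := cardsID H S; lia.
rewrite lt0n cards_eq0; apply/eqP => SH0.
have := fH (mix H x (mix H a z)) _; rewrite fS => [|i iS]; last first.
  by rewrite !ffunE; case: (boolP (i \in H)) => // iH; have := in_set0 i; rewrite -SH0 inE iS iH.
move=> e; have : b = ~~ b by rewrite -{1}fz; apply: e => i iH; rewrite ffunE iH.
by case: b {e fz fH fc}.
Qed.

(** Variables with [sigma f i >= L] weigh at most [2 ^ - L] each. If another one is sensitive at [x]
    then [sens_at f x <= L], so the truncation is idle there and the sensitivity lost by restricting
    [H] pays for its influence. *)
Lemma sum_sweight_local f H L :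
  \sum_(i in H) sweight R f i + avg (fun x => (minn (sens_at (restr f H x) x) L)%:R)
  <= #|H|%:R / 2 ^+ L + avg (fun x => (minn (sens_at f x) L)%:R).
Proof.
pose K := [set i in H | (sigma f i < L)%N].
apply: (@le_trans _ _ (#|H|%:R / 2 ^+ L + avg (fun x => \sum_(i in K) (sbit f x i)%:R)
    + avg (fun x => (minn (sens_at (restr f H x) x) L)%:R))).
  rewrite lerD2r avg_sum mulr_natl -sumr_const.
  rewrite [X in _ + X](_ : _ = \sum_(i in H) if (sigma f i < L)%N then influence R f i else 0).
    rewrite -big_split /=; apply: ler_sum => i iH; case: ltnP => l.
      apply: le_trans (weight_le_influence f i (@sweight_is_weight R n)) _.
      by rewrite lerDr invr_ge0 exprn_ge0.
    rewrite addr0 /sweight; case: ifP => _; last by rewrite invr_ge0 exprn_ge0.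
    by rewrite lef_pV2 ?posrE ?pow2_gt0 // ler_eXn2l ?ltr1n.
  by rewrite -big_mkcondr /=; apply: eq_bigl => i; rewrite inE.
rewrite -addrA lerD2l -avgD; apply: ler_avg => x.
rewrite -natr_sum -natrD ler_nat.
have -> : (\sum_(i in K) sbit f x i = #|[set i in K | sbit f x i]|)%N.
  rewrite -sum1_card big_mkcond [RHS]big_mkcond /=; apply: eq_bigr => i _.
  rewrite (_ : (i \in [set i in K | sbit f x i]) = (i \in K) && sbit f x i); last by rewrite inE.
  by case: (i \in K) => //=; case: (sbit f x i).
have := sens_at_restr f H x x; rewrite mixid => e.
have KH : (#|[set i in K | sbit f x i]| <= #|[set j in H | sbit f x j]|)%N.
  by apply/subset_leq_card/subsetP => i; rewrite !inE => /andP[/andP[-> _] ->].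
have [->|[i]] := set_0Vmem [set i in K | sbit f x i]; first by rewrite cards0; lia.
rewrite !inE => /andP[/andP[_ sL] sx]; have := sens_at_sigma sx.
move: KH e; move: (sens_at f x) (sens_at _ x) #|_| #|_| => p q A B; lia.
Qed.

(** Restricting the variables of a certificate for [true] shortens every certificate for [false], so
    [m] rounds make the function constant. A round costs at most [c / 2 ^ L] plus the drop of the
    mean truncated sensitivity, which telescopes. *)
Lemma sum_sweight_cert f m c L : certified f false m -> certified f true c ->
  \sum_i sweight R f i <= (m * c)%:R / 2 ^+ L + avg (fun x => (minn (sens_at f x) L)%:R).
Proof.
elim: m f => [|m IH] f f0 f1.
  rewrite big1 => [|i _]; last first.
    rewrite /sweight; case: ifP => // /relevantP [x sx].
    have [x0 fx0] : exists x0, f x0 = false.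
      by move: sx; rewrite /sbit; case e: (f x); [exists (flip x [set i])|exists x] => //;
         move: sx; case: (f (flip _ _)).
    have [S] := f0 x0 fx0; rewrite leqn0 cards_eq0 => /eqP -> fS.
    by move: sx; rewrite /sbit !(fS _ (fun j => _)) ?eqxx // => j; rewrite inE.
  by apply: addr_ge0; [rewrite divr_ge0 ?exprn_ge0|apply: avg_ge0 => x; rewrite ler0n].
have [x1 fx1|f0x] := pickP (fun x => f x); last first.
  rewrite big1 => [|i _].
    by apply: addr_ge0; [rewrite divr_ge0 ?exprn_ge0|apply: avg_ge0 => x; rewrite ler0n].
  by rewrite /sweight; case: ifP => // /relevantP [x]; rewrite /sbit !f0x.
have [H cH fH] := f1 x1 fx1; rewrite fx1 in fH.
apply: le_trans (sum_weight_restr f H (@sweight_is_weight R n)) _.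
apply: (@le_trans _ _ (\sum_(i in H) sweight R f i + ((m * c)%:R / 2 ^+ L +
    avg (fun x => (minn (sens_at (restr f H x) x) L)%:R)))).
  (* The outer point [y] fixes the restriction and the inner point evaluates it, so the induction
     hypothesis applies for each [y]. *)
  rewrite lerD2l -(avg_mix H (fun x => (minn (sens_at (restr f H x) x) L)%:R)).
  rewrite -[X in _ <= X + _](avg_cst n) -avgD; apply: ler_avg => y.
  have g0 := @certified_restr_opp f false m H y x1 fH f0.
  have g1 := @certified_restr f true c H y f1.
  apply: le_trans (IH _ g0 g1) _.
  rewrite lerD2l; apply: ler_avg => x; rewrite ler_nat.
  suff -> : sens_at (restr f H (mix H y x)) (mix H y x) = sens_at (restr f H y) x by [].
  have -> : restr f H (mix H y x) = restr f H y.
    apply/funext => z; congr f; apply/ffunP => i.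
    by rewrite !ffunE; case: (i \in H).
  apply: eq_card => j; rewrite !inE -![_ != _]/(sbit _ _ _) !sbit_restr.
  suff -> : mix H y (mix H y x) = mix H y x by [].
  by apply/ffunP => i; rewrite !ffunE; case: (i \in H).
rewrite addrCA; apply: le_trans (lerD (lexx _) (sum_sweight_local f H L)) _.
rewrite addrA lerD2r -mulrDl ler_pM2r ?invr_gt0 ?pow2_gt0 // -natrD ler_nat mulSn addnC.
by rewrite leq_add2r.
Qed.

Lemma sum_sweight_le f L : \sum_i sweight R f i <= (cert f ^ 2)%:R / 2 ^+ L + L%:R.
Proof.
have fc b : certified f b (cert f) by move=> x _; apply: certP.
apply: le_trans (sum_sweight_cert L (fc false) (fc true)) _.
rewrite mulnn lerD2l -[leRHS](avg_cst n); apply: ler_avg => x.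
by rewrite ler_nat geq_minr.
Qed.

Lemma sum_sweight_le_sens f : \sum_i sweight R f i <= (sens f)%:R.
Proof.
apply: le_trans (sum_influence_le_sens R f); apply: ler_sum => i _.
exact: weight_le_influence (@sweight_is_weight R n).
Qed.

Lemma ln_pow2 k s : (2 ^ k <= s)%N -> k%:R / 2 <= ln s%:R :> R.
Proof.
move=> ks; have ln2 : 1 / 2 <= ln 2 :> R.
  have := @le_ln1Dx R (- (1 / 2)); rewrite (_ : 1 + - (1 / 2) = 2^-1) ?lnV ?posrE //; last by lra.
  by move=> H; have := H ltac:(lra); lra.
apply: (@le_trans _ _ (ln (2 ^+ k))).
  rewrite lnXn // -[leRHS]mulr_natl ler_wpM2l ?ler0n //; lra.
by rewrite ler_ln ?posrE ?exprn_gt0 // -?natrX ?ler_nat // ltr0n; apply: leq_trans ks; rewrite expn_gt0.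
Qed.

Lemma nrelevant_cert_sens f : boolfun_nonconstant f ->
  (nrelevant f)%:R <= (ln (sens f)%:R + 29 / 100) * 4 `^ (((cert f)%:R + (sens f)%:R) / 2) :> R.
Proof.
move=> _; have -> : 4 `^ (((cert f)%:R + (sens f)%:R) / 2) = 2 ^+ cert f * 2 ^+ sens f :> R.
  rewrite -natrD -exprD (_ : 4 = 2 `^ 2%:R); last by rewrite powR_mulrn // expr2; lra.
  by rewrite -powRrM mulrC divfK ?pnatr_eq0 // powR_mulrn.
set s := sens f; set c := cert f; set u : R := 2 ^+ c; set v : R := 2 ^+ s.
have four m : 4 ^+ m = (2 ^+ m) ^+ 2 :> R.
  by rewrite -exprM mulnC exprM (_ : 4 = 2 ^+ 2) // expr2; lra.
have n0 := ler0n R (nrelevant f).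
have [/set0Pn [i]|] := boolP ([set i | relevant f i] != set0); last first.
  rewrite negbK => /eqP e; rewrite /nrelevant e cards0 mulr_ge0 ?mulr_ge0 ?exprn_ge0 //.
  (* At [s = 0] the logarithm takes its default value 0. *)
  rewrite addr_ge0 ?divr_ge0 //; have [->|s0] := posnP s; first by rewrite ln0.
  by rewrite ln_ge0 // ler1n.
rewrite inE => ri; have s1 : (0 < s)%N := sens_gt0 ri.
pose V := \sum_i sweight R f i.
have Vs : V <= s%:R := sum_sweight_le_sens f.
have nV : (nrelevant f)%:R <= V * v ^+ 2 / 4.
  have := @nrelevant_le R n f (4 / 4 ^+ s) V (sweight R f) _ (@sweight_ge R n f) (lexx _).
  rewrite four mulrA ler_pdivrMr ?exprn_gt0 // -/v => H; rewrite ler_pdivlMr ?ltr0n //.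
  by apply: H => j; case: (@sweight_is_weight R n) => /(_ f j)/andP[].
have nC : (nrelevant f)%:R <= u ^+ 2 / 2.
  by have := nrelevant_cert R f; rewrite four -/c -/u; lra.
have u1 : 1 <= u by rewrite exprn_ege1 // ler1n.
have v1 : 1 <= v by rewrite exprn_ege1 // ler1n.
(* The product of [nC] and [nV] bounds the square of the count by [V * (u * v) ^ 2 / 8]. *)
have suffV l : 0 <= l -> V <= 8 * (l + 29 / 100) ^+ 2 -> l <= ln s%:R ->
    (nrelevant f)%:R <= (ln s%:R + 29 / 100) * (u * v).
  move=> l0 Vl ls; apply: (@le_trans _ _ ((l + 29 / 100) * (u * v))); last first.
    by rewrite ler_wpM2r ?lerD2r // mulr_ge0 ?exprn_ge0.
  rewrite -ler_sqr ?nnegrE // ?mulr_ge0 ?exprn_ge0 //; last by lra.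
  rewrite expr2; apply: (@le_trans _ _ (u ^+ 2 / 2 * (V * v ^+ 2 / 4))); first exact: ler_pM.
  rewrite (_ : _ * _ = V * ((u * v) ^+ 2 / 8)); last by field.
  rewrite [leRHS](_ : _ = 8 * (l + 29 / 100) ^+ 2 * ((u * v) ^+ 2 / 8)); last by field.
  by rewrite ler_wpM2r // divr_ge0 // exprn_ge0 // mulr_ge0 ?exprn_ge0.
have lns0 : 0 <= ln s%:R :> R by apply: le_trans (ln_pow2 (_ : 2 ^ 0 <= s)%N); rewrite ?mul0r.
(* For [c >= 2 * s], [nV] alone suffices, as [V <= v] and [v ^ 2 <= u]. *)
have [cs|cs] := leqP (2 * s) c.
  have uv : v ^+ 2 <= u by rewrite -exprM ler_eXn2l ?ltr1n // mulnC.
  have sv : s%:R <= v by rewrite /v -natrX ler_nat ltnW // ltn_expl.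
  apply: le_trans nV _; apply: (@le_trans _ _ (29 / 100 * (u * v))); last first.
    by rewrite ler_wpM2r ?mulr_ge0 ?exprn_ge0 // lerDr.
  apply: (@le_trans _ _ (v * u / 4)).
    by rewrite ler_pM2r ?invr_gt0 // ler_pM ?(le_trans Vs sv) ?exprn_ge0 // sumr_ge0 // => j _;
      case: (@sweight_is_weight R n) => /(_ f j)/andP[].
  have : 0 <= u * v by rewrite mulr_ge0 ?exprn_ge0.
  by rewrite [v * u]mulrC; move: (u * v) => t; lra.
have /andP[ks sk] := trunc_log_bounds (isT : 1 < 2)%N s1.
move: (trunc_log 2 s) ks sk => k ks sk; have lk := ln_pow2 ks.
case: k ks sk lk => [|[|k]] ks sk lk.
(* Here at most one variable is relevant, and [0.29 * 2 * 2] exceeds 1. *)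
- have s1' : s = 1%N by lia.
  have : (nrelevant f)%:R <= 1 :> R.
    by apply: le_trans nV _; move: Vs; rewrite /v s1' expr1 expr2; lra.
  have c0 : (0 < c)%N.
    rewrite lt0n; apply: contraTneq nC => c0; rewrite /u c0 expr0 expr1n -ltNge.
    apply: lt_le_trans (_ : 1 <= _); first lra.
    by rewrite ler1n; apply/card_gt0P; exists i; rewrite inE.
  move=> H; apply: le_trans H _; rewrite /v s1' expr1.
  apply: (@le_trans _ _ (29 / 100 * (2 * 2))); first lra.
  apply: ler_pM; rewrite ?divr_ge0 ?mulr_ge0 ?lerDr ?ln1 //.
  by rewrite ler_pM2r // -{1}(expr1 2) ler_eXn2l ?ltr1n.
- apply: (suffV (1 / 2)) => //; apply: (le_trans Vs).
  apply: (@le_trans _ _ 3); first by rewrite ler_nat; lia.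
  by rewrite expr2; lra.
apply: (suffV (k.+2%:R / 2)) => //.
(* With [s < 2 ^ k.+3] and [c < 2 * s], this truncation level [L] gives [c ^ 2 <= 2 ^ L], so the
   first term is at most 1. *)
apply: le_trans (sum_sweight_le f (2 * k.+2 + 4)) _.
apply: (@le_trans _ _ (1 + (2 * k.+2 + 4)%:R)).
  rewrite lerD2r ler_pdivrMr ?pow2_gt0 // mul1r -[leRHS]natrX ler_nat.
  apply: (@leq_trans ((2 * s) ^ 2)); first by rewrite leq_exp2r // ltnW.
  apply: (@leq_trans ((2 * 2 ^ k.+3) ^ 2)); first by rewrite leq_exp2r // leq_mul2l ltnW.
  by rewrite -expnS -expnM leq_exp2l //; lia.
rewrite natrD natrM -[k.+2]addn2 natrD; move: (k%:R) (ler0n R k) => r r0.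
rewrite expr2; nra.
Qed.

End CertificateSensitivity.

(** * The degree bound for monotone functions *)

Section MonotoneDegree.
Variables (R : realType) (n : nat).
Implicit Types (f : boolfun n) (x y a : cube n) (S T M : {set 'I_n}) (i : 'I_n).

(* The recursion obtained by restricting the variables of a monomial of size [d]:
   two of the [2 ^ d] restrictions are constant. *)
Fixpoint mbound (d : nat) : R :=
  if d is d'.+1 then d%:R / 2 ^+ d + (1 - 2 / 2 ^+ d) * mbound d' else 0.

Lemma mboundS d : mbound d.+1 = d.+1%:R / 2 ^+ d.+1 + (1 - 2 / 2 ^+ d.+1) * mbound d.
Proof. by []. Qed.

Lemma mbound_coef d : (0 <= 1 - 2 / 2 ^+ d.+1 :> R) && (1 - 2 / 2 ^+ d.+1 <= 1 :> R).
Proof.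
rewrite subr_ge0 lerBlDr lerDl divr_ge0 ?exprn_ge0 // andbT.
by rewrite ler_pdivrMr ?pow2_gt0 // mul1r -{1}(expr1 2) ler_eXn2l ?ltr1n.
Qed.

Lemma mbound_ge0 d : 0 <= mbound d.
Proof.
elim: d => // d IH; rewrite mboundS addr_ge0 ?divr_ge0 ?exprn_ge0 ?mulr_ge0 //.
by case/andP: (mbound_coef d).
Qed.

Lemma mbound_half d : mbound d <= d.+1%:R / 2.
Proof.
suff : mbound d <= d%:R / 2 by move/le_trans; apply; rewrite ler_pM2r ?invr_gt0 // ler_nat.
elim: d => [|d IH]; first by rewrite mul0r.
rewrite mboundS; have /andP[c0 c1] := mbound_coef d.
have h : d.+1%:R / 2 ^+ d.+1 <= 1 / 2 :> R.
  rewrite exprS invfM mulrA mulrAC ler_pM2r ?invr_gt0 // ler_pdivrMr ?pow2_gt0 //.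
  by rewrite mul1r -natrX ler_nat ltn_expl.
have := ler_wpM2r (mbound_ge0 d) c1; rewrite mul1r => H.
by rewrite [d.+1%:R in leRHS]mulrSr; lra.
Qed.

Lemma mbound_mono d : mbound d <= mbound d.+1.
Proof.
rewrite mboundS mulrBl mul1r addrCA lerDl subr_ge0 mulrAC ler_pM2r ?invr_gt0 ?pow2_gt0 //.
by have := mbound_half d; lra.
Qed.

(** The subtracted term is the sum of [m / 2 ^ m] over all [m > 8 + d], which dominates every later
    increment of [mbound]; this makes the induction close. *)
Lemma mbound_tail d : mbound (8 + d) <= 1325 / 1000 - (10 + d)%:R / 2 ^+ (8 + d).
Proof.
have p m k : 2 ^+ m = k%:R :> R -> 2 ^+ m.+1 = (2 * k)%:R :> R by move=> e; rewrite exprS e natrM.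
have p1 : 2 ^+ 1 = 2%:R :> R by rewrite expr1.
have p2 : 2 ^+ 2 = 4%:R :> R := p _ _ p1.
have p3 : 2 ^+ 3 = 8%:R :> R := p _ _ p2.
have p4 : 2 ^+ 4 = 16%:R :> R := p _ _ p3.
have p5 : 2 ^+ 5 = 32%:R :> R := p _ _ p4.
have p6 : 2 ^+ 6 = 64%:R :> R := p _ _ p5.
have p7 : 2 ^+ 7 = 128%:R :> R := p _ _ p6.
have p8 : 2 ^+ 8 = 256%:R :> R := p _ _ p7.
elim: d => [|d IH].
  have b1 : mbound 1 = 1 / 2 by rewrite mboundS p1 /=; lra.
  have b2 : mbound 2 = 3 / 4 by rewrite mboundS p2 b1; lra.
  have b3 : mbound 3 = 15 / 16 by rewrite mboundS p3 b2; lra.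
  have b4 : mbound 4 <= 108 / 100 by rewrite mboundS p4 b3; lra.
  have b5 : mbound 5 <= 117 / 100 by rewrite mboundS p5; move: (mbound 4) b4 => b b4; lra.
  have b6 : mbound 6 <= 1228 / 1000 by rewrite mboundS p6; move: (mbound 5) b5 => b b5; lra.
  have b7 : mbound 7 <= 1264 / 1000 by rewrite mboundS p7; move: (mbound 6) b6 => b b6; lra.
  by rewrite !addn0 mboundS p8; move: (mbound 7) b7 => b b7; lra.
rewrite !addnS mboundS; have [c0 c1] := andP (mbound_coef (8 + d)).
have := ler_wpM2l c0 IH; rewrite exprS.
have u256 : 4 * (10 + d)%:R <= 2 ^+ (8 + d) :> R.
  rewrite exprD p8 -natrX -!natrM ler_nat.
  by have := ltn_expl d (isT : 1 < 2)%N; move: (2 ^ d)%N => t; lia.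
move: c0 c1 IH u256 (pow2_gt0 R (8 + d)); rewrite exprS; move: (2 ^+ _) => u.
rewrite ![(_ + d)%:R]natrD [(8 + d).+1%:R]mulrSr natrD [(10 + d).+1%:R]mulrSr natrD.
move: (mbound _) (d%:R) (ler0n R d) => b r r0 c0 c1 IH u256 u0 H.
apply: le_trans (lerD (lexx _) H) _.
rewrite -subr_ge0 [X in 0 <= X](_ : _ = (265 / 100 * u - 2 * (10 + r)) / 2 / u / u); last first.
  by field; rewrite gt_eqF.
rewrite !divr_ge0 ?(ltW u0) //; lra.
Qed.

Lemma mbound_le d : mbound d <= 1325 / 1000.
Proof.
have le m : mbound d <= mbound (m + d) by elim: m => // m; move/le_trans; apply; apply: mbound_mono.
apply: le_trans (le 8) _; apply: le_trans (mbound_tail d) _.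
by rewrite gerBl divr_ge0 ?exprn_ge0.
Qed.

Lemma monotone_restr f H a : boolfun_monotone f -> boolfun_monotone (restr f H a).
Proof. by move=> fm x y xy; apply: fm => i; rewrite !ffunE; case: ifP. Qed.

(** By [bder_max] some flip inside [M] changes [f x]. When [x] is constantly [b] on [M], all such
    flips go in one direction, so monotonicity decides the value. *)
Lemma monotone_top f M b x : boolfun_monotone f -> M != set0 -> maxset (mono R f) M ->
  {in M, forall i, x i = b} -> f x = b.
Proof.
move=> fm M0 /(bder_max x) d xb; have [U UM] := bder_sens M0 d.
have xU i : if b then (flip x U i <= x i)%N else (x i <= flip x U i)%N.
  rewrite ffunE; case: (boolP (i \in U)) => [/(subsetP UM) /xb ->|_]; case: b {xb} => //.
by case: b xU {xb} => /fm; case: (f x); case: (f _).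
Qed.

Lemma sum_dweight_cst f b : (forall x, f x = b) -> \sum_i dweight R f i = 0.
Proof.
move=> fb; apply: big1 => i _; rewrite /dweight; case: ifP => // /relevantP [x].
by rewrite /sbit !fb eqxx.
Qed.

(** Monomials of the top size pairwise meet, so restricting the variables of one of them lowers the
    degree; two of the restrictions are constant and contribute nothing. *)
Lemma sum_dweight_monotone f d : boolfun_monotone f ->
  (forall S, mono R f S -> (#|S| <= d)%N) -> \sum_i dweight R f i <= 2 * mbound d.
Proof.
elim: d f => [|d IH] f fm fd.
  rewrite big1 ?mulr0 // => i _; rewrite /dweight; case: ifP => //.
  by rewrite -(mono1 R) => /fd; rewrite cards1.
case: (pickP (fun M => mono R f M && (#|M| == d.+1))) => [M /andP[mM /eqP cM]|none]; last first.
  apply: le_trans (IH f fm _) _ => [S mS|].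
    rewrite -ltnS ltn_neqAle fd // andbT.
    by have := none S; rewrite mS /= => ->.
  by rewrite ler_pM2l ?ltr0n // mbound_mono.
have top S : mono R f S -> #|S| = d.+1 -> S != set0 /\ maxset (mono R f) S.
  move=> mS cS; split; first by rewrite -cards_eq0 cS.
  by apply/maxsetP; split=> // T mT ST; apply/esym/eqP; rewrite eqEcard ST cS fd.
have [M0 maxM] := top M mM cM.
pose cst b : cube n := [ffun=> b].
pose K b x : R := (in_subcube M (cst b) x)%:R.
have wle x : \sum_i dweight R (restr f M x) i <= 2 * mbound d * (1 - (K false x + K true x)).
  have fK b : in_subcube M (cst b) x -> \sum_i dweight R (restr f M x) i = 0.
    move=> /in_subcubeP xb; apply: (@sum_dweight_cst _ b) => y; apply: monotone_top fm M0 maxM _ => i iM.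
    by rewrite ffunE iM xb // ffunE.
  rewrite /K; case: (boolP (in_subcube M (cst false) x)) => x0.
    rewrite (fK _ x0); case: (boolP (in_subcube M (cst true) x)) => x1; last by rewrite addr0 subrr mulr0.
    have [i iM] := set0Pn _ M0.
    by move/in_subcubeP: x0 => /(_ i iM); move/in_subcubeP: x1 => /(_ i iM) ->; rewrite !ffunE.
  case: (boolP (in_subcube M (cst true) x)) => x1.
    by rewrite (fK _ x1) add0r subrr mulr0.
  rewrite addr0 subr0 mulr1; apply: IH => [|T mT]; first exact: monotone_restr.
  have [mfT dT] := mono_restr mT; rewrite -ltnS ltn_neqAle fd // andbT; apply/eqP => cT.
  have [T0 maxT] := top T mfT cT.
  (* A top monomial [T] disjoint from [M] would force both values of [f] at the indicator of [T]. *)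
  pose z : cube n := [ffun i => i \in T].
  have fz1 : f z = true by apply: monotone_top fm T0 maxT _ => i iT; rewrite ffunE iT.
  have : f z = false.
    by apply: monotone_top fm M0 maxM _ => i iM; rewrite ffunE (disjointFl dT iM).
  by rewrite fz1.
apply: le_trans (sum_weight_restr f M (@dweight_is_weight R n)) _.
apply: (@le_trans _ _ (d.+1%:R * (2 / 2 ^+ d.+1) + 2 * mbound d * (1 - 2 / 2 ^+ d.+1))); last first.
  rewrite mboundS; move: (2 ^+ _)^-1 => u; move: (mbound d) (_%:R) => b r.
  by rewrite le_eqVlt; apply/orP; left; apply/eqP; ring.
apply: lerD.
  rewrite -cM mulr_natl -sumr_const; apply: ler_sum => i iM.
  rewrite /dweight (mono_relevant mM iM) ler_pM2l ?ltr0n // lef_pV2 ?posrE ?pow2_gt0 //.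
  by rewrite ler_eXn2l ?ltr1n // locdeg_ge.
apply: le_trans (ler_avg wle) _; rewrite avgZ ler_wpM2l ?mulr_ge0 ?mbound_ge0 //.
have -> : avg (fun x => 1 - (K false x + K true x)) = 1 - (avg (K false) + avg (K true)).
  by rewrite -avgD; apply/eqP; rewrite eq_sym subr_eq -avgD; apply/eqP;
     rewrite -[LHS](avg_cst n); apply: eq_avg => x; rewrite subrK.
have Kb b : 1 / 2 ^+ d.+1 <= avg (K b).
  by rewrite ler_pdivrMr ?pow2_gt0 // mulrC -cM; apply: in_subcube_avg.
have := Kb false; have := Kb true; move: (avg _) (avg _) (2 ^+ _) => p q u; lra.
Qed.

Lemma nrelevant_monotone_deg f : boolfun_monotone f ->
  (nrelevant f)%:R <= 1325 / 1000 * 2 ^+ deg R f :> R.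
Proof.
move=> fm; have H := sum_dweight_monotone fm (fun S => @mono_deg R n f S).
have : (nrelevant f)%:R * (2 / 2 ^+ deg R f) <= 2 * (1325 / 1000) :> R.
  apply: (nrelevant_le (w := dweight R f)) (le_trans H _) => [i|i ri|].
  - exact: dweight_ge0.
  - rewrite /dweight ri ler_pM2l ?ltr0n // lef_pV2 ?posrE ?pow2_gt0 // ler_eXn2l ?ltr1n //.
    by apply: locdeg_le => S /mono_deg.
  by rewrite ler_pM2l ?ltr0n // mbound_le.
by rewrite mulrA ler_pdivrMr ?pow2_gt0 //; move: (2 ^+ _) (_%:R) => u m; lra.
Qed.

End MonotoneDegree.

(** * Decision trees of monotone functions *)

Section DecisionTrees.
Variable n : nat.
Implicit Types (f g : boolfun n) (x y : cube n) (i j : 'I_n) (t : dtree n) (b : bool).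

Definition const_cube b : cube n := [ffun=> b].

Definition fix_bit f i b : boolfun n := restr f [set i] (const_cube b).

Lemma fix_bit_id f i x : fix_bit f i (x i) x = f x.
Proof.
by congr f; apply/ffunP => j; rewrite !ffunE inE; case: eqP => // ->.
Qed.

Lemma fix_bitC f i j b c : i != j -> fix_bit (fix_bit f i b) j c = fix_bit (fix_bit f j c) i b.
Proof.
move=> ij; apply/funext => x; congr f; apply/ffunP => m; rewrite !ffunE !inE.
by have [->|] := eqVneq m i; rewrite ?(negPf ij).
Qed.

Fixpoint dt_fix i b t : dtree n :=
  match t with
  | Leaf c => Leaf c
  | Query j t0 t1 =>
      if j == i then (if b then dt_fix i b t1 else dt_fix i b t0)
      else Query j (dt_fix i b t0) (dt_fix i b t1)
  end.

Lemma dt_fix_eval i b t x : dt_eval (dt_fix i b t) x = dt_eval t (mix [set i] (const_cube b) x).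
Proof.
elim: t => [c|j t0 IH0 t1 IH1] //=; rewrite !ffunE inE; case: eqP => _ /=.
  by case: b IH0 IH1.
by rewrite IH0 IH1.
Qed.

Lemma dt_fix_depth i b t : (dt_depth (dt_fix i b t) <= dt_depth t)%N.
Proof.
elim: t => [c|j t0 IH0 t1 IH1] //=; case: eqP => _ /=; last first.
  by rewrite ltnS geq_max !leq_max IH0 IH1 orbT.
by apply: leqW; rewrite leq_max; case: b IH0 IH1 => IH0 IH1; rewrite ?IH0 ?IH1 ?orbT.
Qed.

Lemma dt_fix_computes i b t0 t1 f : dt_computes (Query i t0 t1) f ->
  dt_computes (dt_fix i b (if b then t1 else t0)) (fix_bit f i b).
Proof.
move=> c x; rewrite dt_fix_eval /fix_bit /restr -c /= ffunE set11 ffunE.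
by case: b.
Qed.

(* A tree for [x_i /\ g] with [g] independent of [i] must query [i] on the way
   to every accepting leaf; that query can be dropped. *)
Lemma dt_forced d t f i b : (dt_depth t <= d)%N -> dt_computes t f ->
  (forall x, f x = b -> x i = b) -> (exists x, f x = b) ->
  exists2 t', (dt_depth t' < d)%N & dt_computes t' (fix_bit f i b).
Proof.
elim: d t f => [|d IH] [c|j t0 t1] f //= dt cf fi [x fx].
- have := fi (const_cube (~~ b)); rewrite -cf /= -[c]/(dt_eval (Leaf c) x) cf fx ffunE.
  by move=> /(_ erefl); case: (b).
- have := fi (const_cube (~~ b)); rewrite -cf /= -[c]/(dt_eval (Leaf c) x) cf fx ffunE.
  by move=> /(_ erefl); case: (b).
move: dt; rewrite ltnS geq_max => /andP[d0 d1].
have [ji|ji] := eqVneq j i.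
  rewrite ji in cf; exists (dt_fix i b (if b then t1 else t0)); last exact: dt_fix_computes.
  by rewrite ltnS; apply: leq_trans (dt_fix_depth _ _ _) _; case: (b).
have sub c : (exists2 t', (dt_depth t' < d)%N & dt_computes t' (fix_bit (fix_bit f j c) i b)) \/
    forall y, fix_bit f j c y = ~~ b.
  have [[y fy]|no] := pselect (exists y, fix_bit f j c y = b).
    left; apply: (IH (dt_fix j c (if c then t1 else t0))); last by exists y.
    - by apply: leq_trans (dt_fix_depth _ _ _) _; case: (c).
    - exact: dt_fix_computes.
    by move=> z /fi; rewrite ffunE inE eq_sym (negPf ji).
  right=> y; case e: (fix_bit f j c y) => //; case: (b) no => no //.
    by case: no; exists y.
  by case: no; exists y.
(* The branch containing [x] attains [b], hence [0 < d], which leaves room for a leaf in a branch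
   that is constantly [~~ b]. *)
have d_gt0 : (0 < d)%N.
  have [[t' dt' _]|no] := sub (x j); first by apply: leq_ltn_trans dt'.
  by have := no x; rewrite fix_bit_id fx; case: (b).
have {}sub c : exists2 t', (dt_depth t' < d)%N & dt_computes t' (fix_bit (fix_bit f j c) i b).
  have [//|no] := sub c; exists (Leaf (~~ b)) => // y; rewrite /= -(no (mix [set i] (const_cube b) y)).
  by [].
have [u0 du0 cu0] := sub false; have [u1 du1 cu1] := sub true.
exists (Query j u0 u1); first by rewrite /= ltnS gtn_max du0 du1.
move=> y /=; rewrite -[RHS](fix_bit_id _ j) fix_bitC 1?eq_sym //.
by case: (y j).
Qed.

Lemma relevant_fix f i : [set j | relevant f j] \subset
  i |: ([set j | relevant (fix_bit f i false) j] :|: [set j | relevant (fix_bit f i true) j]).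
Proof.
apply/subsetP => j; rewrite !inE => rj; have [//|ji] := eqVneq j i.
have := relevant_split (const_cube false) ji rj.
suff -> : restr f [set i] (flip (const_cube false) [set i]) = fix_bit f i true by [].
by apply/funext => x; congr f; apply/ffunP => m; rewrite !ffunE; case: (m \in _).
Qed.

(** Every sensitive edge in a direction other than [i] has an end of value [b], so it lies in the
    half where bit [i] is [b]. *)
Lemma nrelevant_forced f i b : (forall x, f x = b -> x i = b) ->
  (nrelevant f <= (nrelevant (fix_bit f i b)).+1)%N.
Proof.
move=> fi; rewrite /nrelevant.
apply: leq_trans (_ : #|i |: [set j | relevant (fix_bit f i b) j]| <= _)%N; last first.
  by rewrite cardsU1; case: (i \in _); rewrite ?add0n ?add1n ?leqnSn.
apply/subset_leq_card/subsetP => j; rewrite !inE => /relevantP [x sx].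
have [//|ji] := eqVneq j i; apply/relevantP; exists x; rewrite sbit_restr inE ji /=.
have xi : x i = b.
  have [/fi //|fx] := eqVneq (f x) b.
  have /fi : f (flip x [set j]) = b.
    by move: sx fx; rewrite /sbit; case: (f x) (f (flip x [set j])) (b) => [] [] [].
  by rewrite ffunE inE eq_sym (negPf ji).
suff -> : mix [set i] (const_cube b) x = x by [].
by apply/ffunP => m; rewrite !ffunE inE; case: eqP => // ->.
Qed.

Lemma mix_relevant f (H : {set 'I_n}) a x :
  (forall i, relevant f i -> i \in H) -> f (mix H a x) = f a.
Proof.
move=> fH; have e (T : {set 'I_n}) : [disjoint T & H] -> f (flip a T) = f a.
  elim/set_ind1: T => [|h T hT IH]; first by rewrite flip0.
  move=> dT; rewrite setUC -flipU; last by rewrite disjoint_sym disjoints1.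
  rewrite -IH; last by apply: disjointWl dT; apply: subsetUr.
  apply/eqP; rewrite eq_sym; apply: contraTT dT => s; apply/negP => dT.
  have /fH hH : relevant f h by apply/existsP; exists (flip a T).
  by have := disjointFl dT hH; rewrite !inE eqxx.
rewrite -(e [set i | (i \notin H) && (x i != a i)]); last first.
  by rewrite -setI_eq0; apply/eqP/setP => i; rewrite !inE; case: (i \in H); rewrite ?andbF.
congr f; apply/ffunP => i; rewrite !ffunE inE; case: (i \in H) => //=.
by case: (x i); case: (a i).
Qed.

(** Otherwise let [w] agree with [x] on the variables of [f] and with [y] elsewhere: [f w] is true,
    yet on the variables of [g] the point [w] is below [y], so [g w] is false. *)
Lemma monotone_interpolant f g x y : boolfun_monotone g -> (forall z, (f z <= g z)%N) ->
  f x = true -> g y = false ->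
  exists i, [/\ i \in [set i | relevant f i] :&: [set i | relevant g i], x i = true & y i = false].
Proof.
move=> gm fg fx gy.
case: (pickP (fun i => [&& i \in [set i | relevant f i] :&: [set i | relevant g i], x i & ~~ y i])).
  by move=> i /and3P[iC xi /negPf yi]; exists i.
move=> none; pose Rf := [set i | relevant f i]; pose w := mix Rf x y.
have fw : f w by rewrite /w mix_relevant // => i ri; rewrite inE.
have wy : g w = g (mix [set i | relevant g i] w y).
  by rewrite mix_relevant // => i ri; rewrite inE.
have : (g (mix [set i | relevant g i] w y) <= g y)%N.
  apply: gm => i; have := none i; rewrite /w /Rf !ffunE !inE.
  by case: (relevant f i); case: (relevant g i); case: (x i); case: (y i).
by rewrite -wy gy; have := fg w; rewrite fw; case: (g w).
Qed.

(** The case [m.+2] is reached only from [k = 3] on; the value 3 at [k = 2] would break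
    [tree_bound_double]. *)
Definition tree_bound (k : nat) : nat :=
  match k with
  | 0 => 0 | 1 => 1 | 2 => 2
  | m.+2 => 2 ^ m + 2
  end.

Lemma tree_bound_succ k : ((tree_bound k).+1 <= tree_bound k.+1)%N.
Proof.
case: k => [|[|[|k]]] //; rewrite /tree_bound; have := expn_gt0 2 k; rewrite !expnS.
by move: (2 ^ k)%N => u; lia.
Qed.

Lemma tree_bound_double k : (2 + 2 * tree_bound k <= tree_bound k.+2)%N.
Proof.
case: k => [|[|[|k]]] //; rewrite /tree_bound; have := expn_gt0 2 k; rewrite !expnS.
by move: (2 ^ k)%N => u; lia.
Qed.

Lemma tree_bound_add k : (tree_bound k + tree_bound k.+1 <= tree_bound k.+2)%N.
Proof.
case: k => [|[|[|k]]] //; rewrite /tree_bound; have := expn_gt0 2 k; rewrite !expnS.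
by move: (2 ^ k)%N => u; lia.
Qed.

Lemma tree_bound_three k : (3 <= tree_bound k)%N -> (2 * tree_bound k <= tree_bound k.+1 + 2)%N.
Proof.
case: k => [|[|[|k]]] //; rewrite /tree_bound; have := expn_gt0 2 k; rewrite !expnS.
by move: (2 ^ k)%N => u; lia.
Qed.

Lemma nrelevant_const f b : (forall x, f x = b) -> nrelevant f = 0%N.
Proof.
move=> fb; apply/eqP; rewrite cards_eq0; apply/eqP/setP => i; rewrite !inE.
by apply/negbTE/negP => /relevantP [x]; rewrite /sbit !fb eqxx.
Qed.

Lemma fix_bit_monotone f i b : boolfun_monotone f -> boolfun_monotone (fix_bit f i b).
Proof. by move=> fm x y xy; apply: fm => j; rewrite !ffunE; case: ifP. Qed.

(** The count is at most [|R0| + |R1| - |R0 :&: R1| + 1]. Few common variables are compensated by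
    forcing, through [monotone_interpolant] and [dt_forced]. *)
Lemma nrelevant_tree k t f : boolfun_monotone f -> dt_computes t f -> (dt_depth t <= k)%N ->
  (nrelevant f <= tree_bound k)%N.
Proof.
elim/ltn_ind: k t f => k IH [b|z t0 t1] f fm ct /= dk.
  by rewrite (@nrelevant_const f b) // => x; rewrite -ct.
case: k IH dk => [|k] // IH; rewrite ltnS geq_max => /andP[d0 d1].
pose g b := fix_bit f z b.
have gm b : boolfun_monotone (g b) by apply: fix_bit_monotone.
pose u b := dt_fix z b (if b then t1 else t0).
have cu b : dt_computes (u b) (g b) by apply: dt_fix_computes.
have du b : (dt_depth (u b) <= k)%N.
  by apply: leq_trans (dt_fix_depth _ _ _) _; case: b.
have gk b : (nrelevant (g b) <= tree_bound k)%N by apply: (IH k _ (u b)).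
have g01 x : (g false x <= g true x)%N.
  by apply: fm => i; rewrite !ffunE; case: ifP.
set R0 := [set i | relevant (g false) i]; set R1 := [set i | relevant (g true) i].
have nf : (nrelevant f <= (#|R0 :|: R1|).+1)%N.
  apply: leq_trans (subset_leq_card (relevant_fix f z)) _.
  by rewrite cardsU1; case: (z \in _); rewrite ?add0n ?add1n ?leqnSn.
have e0 : #|R0| = nrelevant (g false) by [].
have e1 : #|R1| = nrelevant (g true) by [].
have nU := cardsUI R0 R1.
have k1 := tree_bound_succ k.
have [x0 gx0|no] := pickP (fun x => g false x); last first.
  have e : nrelevant (g false) = 0%N by apply: (@nrelevant_const _ false).
  by have := gk true; lia.
have [x1 gx1|no] := pickP (fun x => ~~ g true x); last first.
  have e : nrelevant (g true) = 0%N.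
    by apply: (@nrelevant_const _ true) => x; have := no x; case: (g true x).
  by have := gk false; lia.
move/negbTE in gx1.
have inter := monotone_interpolant (gm true) g01.
(* A forced variable costs one in the count and saves one level of the tree. *)
have forced i b : (forall x, g b x = ~~ b -> x i = ~~ b) ->
    exists k', k = k'.+1 /\ (nrelevant (g b) <= (tree_bound k').+1)%N.
  move=> gi; have ex : exists x, g b x = ~~ b by case: (b); [exists x1|exists x0].
  have [t' dt' ct'] := dt_forced (du b) (cu b) gi ex.
  case: k IH d0 d1 du gk k1 dt' {inter} => // k' IH *; exists k'; split=> //.
  apply: leq_trans (nrelevant_forced gi) _; rewrite ltnS; apply: (IH k' _ t') => //.
  by apply: fix_bit_monotone.
have [i [iC _ _]] := inter x0 x1 gx0 gx1.
have C0 : (0 < #|R0 :&: R1|)%N by apply/card_gt0P; exists i.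
have g0k := gk false; have g1k := gk true.
have [C3|] := leqP 3 #|R0 :&: R1|.
  have C3' : (3 <= tree_bound k)%N.
    apply: leq_trans C3 _; apply: leq_trans (subset_leq_card (subsetIl _ _)) _; exact: g0k.
  have := tree_bound_three C3'; lia.
(* A single common variable must separate every pair of points, so it is forced in both
   subfunctions. *)
rewrite ltnS => C2; have [/cards1P [y eC]|C1] := boolP (#|R0 :&: R1| == 1%N).
  have [|k' [ek h0]] := forced y false.
    move=> x gx; have [j [jC xj _]] := inter x x1 gx gx1.
    by move: jC; rewrite -/R0 -/R1 eC inE => /eqP <-.
  have [|k'' [ek' h1]] := forced y true.
    move=> x gx; have [j [jC _ xj]] := inter x0 x gx0 gx.
    by move: jC; rewrite -/R0 -/R1 eC inE => /eqP <-.
  have ekk : k'' = k' by lia.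
  have := tree_bound_double k'; rewrite ekk in h1; rewrite ek.
  have : #|R0 :&: R1| = 1%N by rewrite eC cards1.
  lia.
have /cards2P [y [y' [yy' eC]]] : #|R0 :&: R1| == 2.
  by rewrite eqn_leq C2 ltn_neqAle eq_sym C1 C0.
(* With two common variables, a point of [g false] at which [y] is off leaves only [y'] to separate
   it, so [y'] is forced in [g true]. *)
have [f0y|[x [gx xy]]] : (forall x, g false x = true -> x y = true) \/
    exists x, g false x = true /\ x y = false.
  have [ex|H] := pselect (exists x, g false x = true /\ x y = false); first by right.
  by left=> x gx; case e: (x y) => //; case: H; exists x.
  have [k' [ek h0]] := forced y false f0y.
  have := tree_bound_add k'; rewrite ek in g1k *; lia.
have [k' [ek h1]] : exists k', k = k'.+1 /\ (nrelevant (g true) <= (tree_bound k').+1)%N.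
  apply: (forced y' true) => x' gx'; have [j [jC xj x'j]] := inter x x' gx gx'.
  move: jC; rewrite -/R0 -/R1 eC !inE => /orP[] /eqP jy; rewrite jy in xj x'j => //.
  by rewrite xj in xy.
have := tree_bound_add k'; rewrite ek in g0k *; lia.
Qed.

Lemma nrelevant_DT f : boolfun_monotone f -> (nrelevant f <= tree_bound (DT f))%N.
Proof.
move=> fm; rewrite /DT; case: ex_minnP => d /asboolP [t ct <-] _.
exact: nrelevant_tree fm ct _.
Qed.

End DecisionTrees.

(** * Assembly of the five bounds *)

Lemma tree_bound_le (R : realType) k : (tree_bound k)%:R <= 1 / 4 * 2 ^+ k + 2 :> R.
Proof.
case: k => [|[|[|k]]] /=; rewrite ?exprS ?expr0; try lra.
rewrite natrD natrX exprS; move: (2 ^+ k) => u; lra.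
Qed.

Theorem theorem1 (R : realType) (n : nat) (f : boolfun n) :
  [/\ (nrelevant f)%:R <= 4394 / 1000 * 2 ^+ deg R f :> R,
      (nrelevant f)%:R <= 1 / 2 * 4 ^+ cert f :> R,
      (nrelevant f)%:R <=
        8277 / 1000 * 2 `^ ((deg R f)%:R / 2 + (sens f)%:R) :> R,
      boolfun_nonconstant f ->
        (nrelevant f)%:R <=
          (ln (sens f)%:R + 29 / 100)
            * 4 `^ (((cert f)%:R + (sens f)%:R) / 2) :> R
    & boolfun_monotone f ->
        (nrelevant f)%:R <=
          Num.min (Num.min (1325 / 1000 * 2 ^+ deg R f)
                           (1 / 2 * 4 ^+ sens f))
                  (1 / 4 * 2 ^+ DT f + 2) :> R].
Proof.
split.
- exact: nrelevant_deg.
- exact: nrelevant_cert.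
- exact: nrelevant_deg_sens.
- exact: nrelevant_cert_sens.
move=> fm; rewrite !le_min nrelevant_monotone_deg //=; apply/andP; split.
  apply: le_trans (nrelevant_cert R f) _; rewrite ler_pM2l ?divr_gt0 //.
  by rewrite ler_eXn2l ?ltr1n // cert_le_sens.
by apply: le_trans (tree_bound_le R (DT f)); rewrite ler_nat nrelevant_DT.
Qed.
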